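(* Let $(\Sigma,\sigma)$ be a topologically transitive countable Markov shift with alphabet $\mathbb{N}$ and with topological entropy $h_{top}<\infty$. Let $\phi:\Sigma\to\mathbb{R}$ be a potential with summable variations and $P(\phi)<\infty$ which has contraction at infinity, i.e. $\delta_{\phi,\infty}<P(\phi)$, and assume that $$\delta_{\phi,\infty}+h_\infty<P(\phi).$$ Then $\phi$ is strongly positive recurrent (SPR).
   Context: Countable Markov shift: given an alphabet $\mathcal{A}=\mathbb{N}=\{1,2,\dots\}$ and a $0$-$1$ transition matrix $M=(M_{i,j})_{i,j\in\mathcal{A}}$, set $\Sigma=\{(x_0,x_1,\dots)\in\mathcal{A}^{\mathbb{N}_0}: M_{x_i,x_{i+1}}=1\ \forall i\ge0\}$ with shift $\sigma(x_0,x_1,\dots)=(x_1,x_2,\dots)$. A $k$-cylinder is $[x_0,\dots,x_{k-1}]=\{y\in\Sigma: y_i=x_i,\ 0\le i\le k-1\}$ for an admissible word $x_0,\dots,x_{k-1}$ (i.e. consecutive letters are allowed transitions); $\mathcal{C}_k$ is the set of $k$-cylinders. The system is topologically transitive if for all $a,b\in\mathcal{A}$ there is $N_{ab}$ (a positive integer) with $[a]\cap\sigma^{-N_{ab}}[b]\ne\emptyset$. Write $S_n\phi=\sum_{i=0}^{n-1}\phi\circ\sigma^i$. The $k$-th variation is $var_k(\phi)=\sup\{|\phi(x)-\phi(y)|: x_i=y_i,\ 0\le i\le k-1\}$; $\phi$ has summable variations if $\sum_{k\ge2}var_k(\phi)<\infty$. Pressure: $P(\phi)$ is the Gurevich pressure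 $P(\phi)=\limsup_{n\to\infty}\frac1n\log\sum_{\sigma^nx=x}e^{S_n\phi(x)}\mathbf{1}_{[a]}(x)$, which is independent of $a\in\mathcal{A}$ by transitivity. The topological entropy is $h_{top}=P(0)$. Strong positive recurrence: for $a\in\mathcal{A}$ and $x\in[a]$ let $\varphi_a(x)=\inf\{k\ge1: x_k=a\}$ and $\overline\sigma_a(x)=\sigma^{\varphi_a(x)}(x)$ be the first return map to $[a]$. For a potential $\psi$ on $\Sigma$ let $\overline\psi=\sum_{i=0}^{\varphi_a-1}\psi\circ\sigma^i$ be the induced potential on $[a]$, and let $P(\overline\psi)$ be its Gurevich pressure for the induced system $([a],\overline\sigma_a)$ (viewed as a full shift whose letters are the first return words to $a$, on points returning infinitely often). Put $$p_a^*[\phi]=\sup\{p\in\mathbb{R}: P(\overline{\phi+p})<\infty\},\qquad \Delta_a[\phi]=P(\overline{\phi+p_a^*[\phi]}),$$ with $\Delta_a[\phi]=+\infty$ if $p_a^*[\phi]=+\infty$. The potential $\phi$ (or the system $(\Sigma,\sigma,\phi)$) is strongly positive recurrent (SPR) if $\Delta_a[\phi]>0$ for some $a\in\mathcal{A}$. Equivalently, for some $a\in\mathcal{A}$, $\limsup_{n\to\infty}\frac1n\log Z_n^*(\phi,a)<P(\phi)$, where $Z_n^*(\phi,a)=\sum_{\sigma^nx=x}e^{S_n\phi(x)}\mathbf{1}_{\{x\in[a]:\,\varphi_a(x)=n\}}(x)$. Quantities at infinity: for $n,M,q\in\mathbb{N}$ let $$B(n,M,q)=\left\{[x_0,\dots,x_n]\in\mathcal{C}_{n+1}: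 x_0,x_n\le q,\ \#\{0\le k\le n: x_k\le q\}\le\tfrac{n+1}{M}\right\}.$$ Entropy at infinity: $z_n(M,q)=\#B(n,M,q)$, $h_\infty(M,q)=\limsup_{n\to\infty}\frac1n\log z_n(M,q)$, $h_\infty(q)=\liminf_{M\to\infty}h_\infty(M,q)$, $h_\infty=\liminf_{q\to\infty}h_\infty(q)$. Moreover $z_{\phi,n}(M,q)=\sup\{\frac1nS_n\phi(x): x\in B\text{ for some }B\in B(n,M,q)\}$ (with $\sup\emptyset=-\infty$), $\delta_{\phi,\infty}(M,q)=\limsup_{n\to\infty}z_{\phi,n}(M,q)$, $\delta_{\phi,\infty}(q)=\liminf_{M\to\infty}\delta_{\phi,\infty}(M,q)$, $\delta_{\phi,\infty}=\liminf_{q\to\infty}\delta_{\phi,\infty}(q)$ (the value $-\infty$ is allowed). *)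

(* Defs.v *)
From mathcomp Require Import all_boot all_order all_algebra.
From mathcomp Require Import all_classical all_reals all_analysis.

Set Implicit Arguments.
Unset Strict Implicit.
Unset Printing Implicit Defensive.

Import Order.TTheory GRing.Theory Num.Theory.

Local Open Scope classical_set_scope.
Local Open Scope ring_scope.

Definition birkhoff (R : realType) (X : Type) (T : X -> X) (psi : X -> R)
    (n : nat) (x : X) : R :=
  \sum_(0 <= i < n) psi (iter i T x).

(* (1/n) log z; the value at n = 0 is irrelevant to the upper limits below *)
Definition log_rate (R : realType) (n : nat) (z : \bar R) : \bar R :=
  ((n%:R^-1)%:E * lne z)%E.

(** Gurevich pressure of a system T on D whose 1-cylinders are the sets
    {x in D | letter x = l}.  It is used both for the shift and for the induced
    systems. *)
Definition gurevich_sum (R : realType) (X : choiceType) (L : eqType)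
    (D : set X) (T : X -> X) (letter : X -> L) (psi : X -> R)
    (l : L) (n : nat) : \bar R :=
  (\esum_(x in [set x | [/\ D x, iter n T x = x & letter x = l]])
     (expR (birkhoff T psi n x))%:E)%E.

Definition gurevich_at (R : realType) (X : choiceType) (L : eqType)
    (D : set X) (T : X -> X) (letter : X -> L) (psi : X -> R) (l : L) : \bar R :=
  limn_esup (fun n => log_rate n (gurevich_sum D T letter psi l n)).

(* For a transitive shift and a potential with summable variations, and for the
   systems induced by it, gurevich_at does not depend on the letter l; taking
   the supremum over the occurring letters selects this common value without
   singling out a letter. *)
Definition gurevich (R : realType) (X : choiceType) (L : eqType)
    (D : set X) (T : X -> X) (letter : X -> L) (psi : X -> R) : \bar R :=
  ereal_sup (gurevich_at D T letter psi @` (letter @` D)).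

(** Countable Markov shifts.  The alphabet is {1, 2, ...}; sequences have type
    nat -> nat and membership in Sigma enforces positive letters.  Potentials
    are functions on all sequences, only their values on Sigma are ever used. *)
Definition Sigma (M : rel nat) : set (nat -> nat) :=
  [set x | forall i, (0 < x i)%N /\ M (x i) (x i.+1)].

Definition shiftmap (x : nat -> nat) : nat -> nat := fun i => x i.+1.

Definition admissible (M : rel nat) (w : seq nat) : bool :=
  all (leq 1) w && sorted M w.

Definition cylinder (M : rel nat) (w : seq nat) : set (nat -> nat) :=
  [set y | Sigma M y /\ forall i, (i < size w)%N -> y i = nth 0%N w i].

Definition transitive_shift (M : rel nat) : Prop :=
  forall a b : nat, (0 < a)%N -> (0 < b)%N ->
    exists N : nat, (0 < N)%N /\
      (cylinder M [:: a] `&` (iter N shiftmap @^-1` cylinder M [:: b])) !=set0.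

Definition varn (R : realType) (M : rel nat) (phi : (nat -> nat) -> R)
    (k : nat) : \bar R :=
  ereal_sup [set r | exists x y, [/\ Sigma M x, Sigma M y,
    (forall i, (i < k)%N -> x i = y i) & r = `|phi x - phi y|%:E]].

Definition summable_variations (R : realType) (M : rel nat)
    (phi : (nat -> nat) -> R) : Prop :=
  (\sum_(2 <= k <oo) varn M phi k < +oo)%E.

Definition pressure (R : realType) (M : rel nat) (phi : (nat -> nat) -> R)
    : \bar R :=
  gurevich (Sigma M) shiftmap (fun x => x 0%N) phi.

Definition htop (R : realType) (M : rel nat) : \bar R :=
  pressure M (fun _ => 0 : R).

(** The system induced on the points of [a] that return to [a] infinitely
    often. *)
Definition recurrent (M : rel nat) (a : nat) : set (nat -> nat) :=
  [set x | cylinder M [:: a] x /\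
           forall N, exists k, (N <= k)%N /\ x k = a].

(* The value 0 on sequences that never return is never used. *)
Definition return_time (a : nat) (x : nat -> nat) : nat :=
  match pselect (exists k, (0 < k)%N && (x k == a)) with
  | left e => ex_minn e
  | right _ => 0%N
  end.

Definition return_map (a : nat) (x : nat -> nat) : nat -> nat :=
  iter (return_time a x) shiftmap x.

(* The first return word x_0 ... x_{phi_a(x) - 1}, which is the letter of x in
   the induced full shift. *)
Definition return_word (a : nat) (x : nat -> nat) : seq nat :=
  mkseq x (return_time a x).

Definition induced_potential (R : realType) (a : nat)
    (psi : (nat -> nat) -> R) (x : nat -> nat) : R :=
  birkhoff shiftmap psi (return_time a x) x.

Definition induced_pressure (R : realType) (M : rel nat) (a : nat)
    (psi : (nat -> nat) -> R) : \bar R :=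
  gurevich (recurrent M a) (return_map a) (return_word a)
    (induced_potential a psi).

Definition pstar (R : realType) (M : rel nat) (a : nat)
    (phi : (nat -> nat) -> R) : \bar R :=
  ereal_sup [set p%:E | p in
    [set p : R | (induced_pressure M a (fun x => (phi x + p)%R) < +oo)%E]].

(* pstar = -oo does not occur for transitive shifts and potentials with summable
   variations and finite pressure. *)
Definition discriminant (R : realType) (M : rel nat) (a : nat)
    (phi : (nat -> nat) -> R) : \bar R :=
  match pstar M a phi with
  | EFin p => induced_pressure M a (fun x => phi x + p)
  | +oo%E => +oo%E
  | -oo%E => -oo%E
  end.

Definition SPR (R : realType) (M : rel nat) (phi : (nat -> nat) -> R) : Prop :=
  exists a : nat, (0 < a)%N /\ (0 < discriminant M a phi)%E.

(** Quantities at infinity. *)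
Definition Binf (M : rel nat) (n m q : nat) : set (set (nat -> nat)) :=
  cylinder M @` [set w | [/\ size w = n.+1, admissible M w,
    (nth 0 w 0 <= q)%N, (nth 0 w n <= q)%N
    & (m * count (fun l => l <= q) w <= n.+1)%N]].

Definition hinf_Mq (R : realType) (M : rel nat) (m q : nat) : \bar R :=
  limn_esup (fun n => log_rate n (counting (Binf M n m q))).

Definition hinf_q (R : realType) (M : rel nat) (q : nat) : \bar R :=
  limn_einf (fun m => hinf_Mq R M m q).

Definition hinf (R : realType) (M : rel nat) : \bar R :=
  limn_einf (fun q => hinf_q R M q).

Definition zphi (R : realType) (M : rel nat) (phi : (nat -> nat) -> R)
    (n m q : nat) : \bar R :=
  ereal_sup [set (n%:R^-1 * birkhoff shiftmap phi n x)%:E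
            | x in \bigcup_(C in Binf M n m q) C].

Definition deltainf_Mq (R : realType) (M : rel nat) (phi : (nat -> nat) -> R)
    (m q : nat) : \bar R :=
  limn_esup (fun n => zphi M phi n m q).

Definition deltainf_q (R : realType) (M : rel nat) (phi : (nat -> nat) -> R)
    (q : nat) : \bar R :=
  limn_einf (fun m => deltainf_Mq M phi m q).

Definition deltainf (R : realType) (M : rel nat) (phi : (nat -> nat) -> R)
    : \bar R :=
  limn_einf (fun q => deltainf_q M phi q).

(* Main.v *)
Require Import Defs.
From mathcomp Require Import all_boot all_order all_algebra.
From mathcomp Require Import all_classical all_reals all_analysis.
From mathcomp Require Import ring lra zify.

(** Write P for the pressure of phi. The potential is seen only through the
    weights [weight phi x w] of finite walks in the transition graph, which by
    summable variations are multiplicative under concatenation up to a constant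
    factor. The tilt by p multiplies the weight of a walk of n steps by
    exp (p n). The pressure is then an abscissa of convergence: the tilted sum
    over all loops at a letter b is finite for p < - P
    ([loops_converge_below_pressure]), and if it is finite for one letter and
    one p then P <= - p ([pressure_le_of_convergence]).

    A letter a witnesses strong positive recurrence as soon as the tilted sum
    over the first return loops at a is finite for some p > - P. Indeed the
    induced pressure of phi + p is then finite ([induced_pressure_lty]), so the
    critical parameter pstar exceeds - P, while at every parameter above - P the
    induced pressure is positive ([induced_pressure_gt0]).

    To find a, consider for a finite set F of letters the excursions from F to
    F, whose interior letters avoid F. For F = {1, ..., q} with a suitable
    large q these converge beyond - P. An excursion of n steps meets F only at its ends,
    so after closing it up by bounded walks it is one of the words counted by
    the quantities at infinity. Hence for real numbers h > [hinf] and
    d > [deltainf] with d + h < P there are at most about exp (h n) such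
    excursions, each of weight at most about exp (d n), and their tilted sum
    converges for p < - (d + h) ([excursion_count_hinf], [excursion_weight_le],
    [excursions_converge_above]).

    The letters of F are then removed one at a time ([eliminate_letter]).
    Removing b replaces the excursions of F by those of the remaining set F',
    and the new ones run through b: they are an excursion from F' to b, some
    loops at b that avoid F', and an excursion from b to F'. The loops at b
    that avoid F' are concatenations of first return loops from a set A which
    does not contain some first return loop g, one that passes through F'.
    Forbidding g costs a definite amount of growth: inserting g, or not, after
    each block of a concatenation of k blocks of A yields 2 ^ k distinct loops
    at b, so that the sum over all loops at b is at least (1 + kappa) ^ k times
    the sum over concatenations of k blocks ([total_forbidden_loop]). Below - P
    the former is finite, so the latter decays exponentially in k, at a rate
    that persists slightly above - P because A itself converges beyond - P
    ([subcritical_without_loop]). When one letter is left, the excursions are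
    its first return loops. *)

Set Implicit Arguments.
Unset Strict Implicit.
Unset Printing Implicit Defensive.

Import Order.TTheory GRing.Theory Num.Theory.

Local Open Scope classical_set_scope.
Local Open Scope ring_scope.

(** * Sums over sets of words, upper limits and exponential rates *)

Section RealEstimates.
Variable R : realType.

Lemma real_between (x : \bar R) (y : R) : (x < y%:E)%E ->
  exists2 c : R, (x < c%:E)%E & (c < y)%R.
Proof.
case: x => [r| |]; rewrite ?lte_fin//.
  by move=> ry; exists ((r + y) / 2)%R; rewrite ?lte_fin; lra.
by move=> _; exists (y - 1)%R; [exact: ltNyr|lra].
Qed.

Lemma expR_eventually_ge (C e : R) : (0 < e)%R ->
  exists n0, forall n, (n0 <= n)%N -> (C <= expR (e * n%:R))%R.
Proof.
move=> e0; exists (Num.truncn (C / e)).+1 => n nn.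
have Cn : (C / e <= n%:R)%R.
  apply: (@le_trans _ _ (Num.truncn (C / e)).+1%:R); last by rewrite ler_nat.
  exact/ltW/truncnS_gt.
rewrite ler_pdivrMr// in Cn; have := expR_ge1Dx (e * n%:R); lra.
Qed.

End RealEstimates.

Section SumsOverSets.
Variable R : realType.
Local Open Scope ereal_scope.

Lemma le_esum_set (T : choiceType) (A B : set T) (f : T -> \bar R) :
  A `<=` B -> \esum_(x in A) f x <= \esum_(x in B) f x.
Proof.
move=> AB; apply: ereal_sup_le => _ [X [finX XA] <-].
by exists X => //; split=> //; apply: subset_trans AB.
Qed.

Lemma le_esum_surj (T T' : choiceType) (E : set T) (D : set T') (e : T -> T')
    (f : T' -> \bar R) :
  (forall y, D y -> 0 <= f y) ->
  D `<=` e @` E -> \esum_(y in D) f y <= \esum_(x in E) f (e x).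
Proof.
move=> f0 DE; have [->|/set0P[y0 Dy0]] := eqVneq D set0.
  rewrite esum_set0; have [->|/set0P[x0 _]] := eqVneq E set0.
    by rewrite esum_set0.
  by apply: le_trans (le_esum_set _ (@sub0set _ E)); rewrite esum_set0.
have [x0 Ex0 _] := DE _ Dy0.
have /boolp.choice[s hs] : forall y, exists x, D y -> E x /\ e x = y.
  move=> y; have [Dy|nDy] := pselect (D y); last by exists x0.
  by have [x Ex exy] := DE _ Dy; exists x.
have -> : \esum_(y in D) f y = \esum_(x in s @` D) f (e x).
  rewrite esum_image; first by apply: eq_esum => y /hs[_ ->].
  by move=> y z /[!inE] /hs[_ {2}<-] /hs[_ {2}<-] ->.
by apply: le_esum_set => _ [y /hs[? _] <-].
Qed.

Lemma le_esum_inj (T T' : choiceType) (E : set T) (D : set T') (e : T -> T')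
    (f : T' -> \bar R) :
  set_inj E e -> e @` E `<=` D -> \esum_(x in E) f (e x) <= \esum_(y in D) f y.
Proof. by move=> einj ED; rewrite -esum_image//; apply: le_esum_set. Qed.

Lemma esumZl (T : choiceType) (D : set T) (c : R) (f : T -> \bar R) :
  (0 <= c)%R -> (forall x, D x -> 0 <= f x) ->
  \esum_(x in D) (c%:E * f x) = c%:E * \esum_(x in D) f x.
Proof.
rewrite le_eqVlt => /orP[/eqP <- _|].
  by rewrite mul0e esum1// => x _; rewrite mul0e.
have half (a : R) (g : T -> \bar R) : (0 < a)%R -> (forall x, D x -> 0 <= g x) ->
    \esum_(x in D) (a%:E * g x) <= a%:E * \esum_(x in D) g x.
  move=> a0 g0; apply: ge_ereal_sup => _ [X [finX XD] <-].
  rewrite fsbig_finite//= big_seq -ge0_sume_distrr; last first.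
    by move=> i; rewrite in_fset_set// inE => /XD /g0.
  rewrite lee_pmul2l ?lte_fin//.
  by apply: esum_ge; exists X => //; rewrite fsbig_finite//= -big_seq.
move=> c0 f0; apply/eqP; rewrite eq_le half//=.
have ci0 : (0 < c^-1)%R by rewrite invr_gt0.
rewrite -(@lee_pmul2l _ c^-1%:E) ?lte_fin// muleA -EFinM mulVf ?gt_eqF// mul1e.
apply: le_trans (half _ _ ci0 _); last by move=> x Dx; rewrite mule_ge0 ?f0// lee_fin ltW.
apply: le_esum => x Dx.
by rewrite muleA -EFinM mulVf ?gt_eqF// mul1e.
Qed.

Lemma esum_setU_le (T : choiceType) (D A B : set T) (f : T -> \bar R) :
  (forall x, 0 <= f x) -> D `<=` A `|` B ->
  \esum_(x in D) f x <= \esum_(x in A) f x + \esum_(x in B) f x.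
Proof.
move=> f0 DAB; rewrite (esumID A)//; apply: leeD; apply: le_esum_set => x [].
  by [].
by move=> /DAB[].
Qed.

Lemma esum_bigcup_le (T : choiceType) (D : set T) (E : nat -> set T)
    (f : T -> \bar R) :
  (forall x, 0 <= f x) -> D `<=` \bigcup_k E k ->
  \esum_(x in D) f x <= \sum_(k <oo) \esum_(x in E k) f x.
Proof.
move=> f0 DE; rewrite nneseries_esumT; last by move=> k; apply: esum_ge0.
rewrite esum_esum//.
apply: (le_esum_surj (e := snd) (f := f)) => // x /DE[k _ Ekx].
by exists (k, x).
Qed.

Lemma nneseries_geometric_lty (f : nat -> \bar R) (n0 : nat) (C r : R) :
  (forall n, 0 <= f n) -> (forall n, f n < +oo) -> (0 <= C)%R -> (0 <= r < 1)%R ->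
  (forall n, (n0 <= n)%N -> f n <= (C * r ^+ n)%:E) ->
  \sum_(n <oo) f n < +oo.
Proof.
move=> f0 foo C0 /andP[r0 r1] fgeo.
rewrite (@nneseries_split _ _ 0 n0)// lte_add_pinfty//.
  by rewrite lte_sum_pinfty// => i _; exact: foo.
rewrite add0n; apply: (@le_lt_trans _ _ (C * (1 - r)^-1)%:E); last exact: ltry.
apply: lime_le; first by apply: is_cvg_nneseries => n _ _; exact: f0.
apply: nearW => n.
apply: (@le_trans _ _ (\sum_(n0 <= k < n) (C * r ^+ k)%:E)).
  by rewrite big_nat [leRHS]big_nat; apply: lee_sum => i /andP[ni _]; apply: fgeo.
have [nn0|/ltnW nn0] := leqP n n0.
  by rewrite big_geq// lee_fin mulr_ge0// invr_ge0 subr_ge0 ltW.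
apply: (@le_trans _ _ (\sum_(0 <= k < n) (C * r ^+ k)%:E)).
  rewrite [leRHS](@big_cat_nat _ _ _ n0)//= leeDr//.
  by apply: sume_ge0 => i _; rewrite lee_fin mulr_ge0// exprn_ge0.
rewrite sumEFin lee_fin -mulr_sumr ler_wpM2l//.
rewrite -[leRHS]mul1r ler_pdivlMr ?subr_gt0// mulrC.
rewrite big_mkord -opprB mulNr -subrX1 opprB lerBlDr lerDl exprn_ge0//.
Qed.

Lemma limn_esup_lt (u : (\bar R)^nat) (c : \bar R) :
  limn_esup u < c -> exists n0, forall n, (n0 <= n)%N -> u n < c.
Proof.
move=> /ereal_inf_lt[_ [V [n0 _ Vn0] <-]] supV; exists n0 => n n0n.
by apply: le_lt_trans supV; apply: ereal_sup_ubound; exists n => //; apply: Vn0.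
Qed.

Lemma limn_esup_le (u : (\bar R)^nat) (c : \bar R) n0 :
  (forall n, (n0 <= n)%N -> u n <= c) -> limn_esup u <= c.
Proof.
move=> uc; apply: (@le_trans _ _ (ereal_sup (u @` [set n | (n0 <= n)%N]))).
  by apply: ereal_inf_lbound; exists [set n | (n0 <= n)%N] => //; exists n0.
by apply: ge_ereal_sup => _ [n /= n0n <-]; apply: uc.
Qed.

Lemma limn_einf_lt (u : (\bar R)^nat) (c : \bar R) n0 :
  limn_einf u < c -> exists2 n, (n0 <= n)%N & u n < c.
Proof.
move=> uc; apply: contrapT => nu.
suff : c <= limn_einf u by rewrite leNgt uc.
rewrite leeNr; apply: (@limn_esup_le _ _ n0) => n n0n.
by rewrite leeN2 leNgt; apply/negP => unc; apply: nu; exists n.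
Qed.

Lemma log_rate_lt n (z : \bar R) (c : R) : (0 < n)%N -> 0 <= z ->
  log_rate n z < c%:E -> z <= (expR (c * n%:R))%:E.
Proof.
move=> n0; have n0' : (0 < n%:R :> R)%R by rewrite ltr0n.
rewrite /log_rate; case: z => [r| |]// z0.
  rewrite lee_fin; have [r0|r0] := leP r 0%R.
    by move=> _; apply: le_trans r0 (expR_ge0 _).
  rewrite lne_EFin// -EFinM lte_fin mulrC ltr_pdivrMr// => /ltW.
  by rewrite -ler_expR lnK.
by rewrite /= gt0_muley ?lte_fin ?invr_gt0.
Qed.

Lemma log_rate_le n (z : \bar R) (c : R) : (0 < n)%N ->
  z <= (expR (c * n%:R))%:E -> log_rate n z <= c%:E.
Proof.
move=> n0; have n0' : (0 < n%:R :> R)%R by rewrite ltr0n.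
rewrite /log_rate; case: z => [r| |] /=.
- rewrite lee_fin; case: ifPn => [_ _|]; first by
    rewrite gt0_muleNy ?lte_fin ?invr_gt0// leNye.
  rewrite -ltNge => r0 rc; rewrite -EFinM lee_fin mulrC ler_pdivrMr//.
  by rewrite -ler_expR lnK.
- by rewrite leye_eq.
- by move=> _; rewrite gt0_muleNy ?lte_fin ?invr_gt0// leNye.
Qed.

End SumsOverSets.

(** * Walks and their weights *)

Section Walks.
Variable M : rel nat.

(** The word [w] lists the letters after the starting one, so that consecutive
    walks concatenate by [++] and loops at a letter form a monoid. *)
Definition walk (x y : nat) : set (seq nat) :=
  [set w | admissible M (x :: w) /\ last x w = y].

Lemma walk_nil x : (0 < x)%N -> walk x x [::].
Proof. by move=> x0; split=> //; rewrite /admissible/= x0. Qed.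

Lemma walk_src x y w : walk x y w -> (0 < x)%N.
Proof. by case=> /andP[/andP[]]. Qed.

Lemma walk_cat x y z w1 w2 :
  walk x y w1 -> walk y z w2 -> walk x z (w1 ++ w2).
Proof.
rewrite /walk /admissible /= all_cat cat_path last_cat.
by move=> [/andP[/andP[-> ->] ->] ->] [/andP[/andP[_ ->] ->] ->].
Qed.

Lemma walk_split x z w1 w2 : walk x z (w1 ++ w2) ->
  walk x (last x w1) w1 /\ walk (last x w1) z w2.
Proof.
rewrite /walk /admissible /= all_cat cat_path last_cat.
move=> [/andP[/and3P[x0 w10 w20] /andP[p1 p2]] lz].
split; split => //; rewrite ?x0 ?w10 ?p1// w20 p2 andbT/= andbT.
have : all (leq 1) (x :: w1) by rewrite /= x0.
by move=> /allP; apply; exact: mem_last.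
Qed.

Lemma walk_tgt x y w : walk x y w -> (0 < y)%N.
Proof.
move=> h; have := h; rewrite -(cats0 w) => /walk_split[_ /walk_src].
by case: h => _ ->.
Qed.

Definition moves (n : nat) (z : nat -> nat) : seq nat :=
  mkseq (fun i => z i.+1) n.

Lemma size_moves n z : size (moves n z) = n.
Proof. exact: size_mkseq. Qed.

Lemma nth_cons_moves n z i : (i <= n)%N -> nth 0%N (z 0%N :: moves n z) i = z i.
Proof. by case: i => [//|i] lein; rewrite /= nth_mkseq. Qed.

Lemma last_moves n z : last (z 0%N) (moves n z) = z n.
Proof.
by rewrite (last_nth 0%N) size_moves -(nth_cons_moves z (leqnn n)).
Qed.

Lemma walk_moves n z : Sigma M z -> walk (z 0%N) (z n) (moves n z).
Proof.
move=> Sz; split; last exact: last_moves.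
apply/andP; split=> /=.
  rewrite (Sz 0%N).1/=; apply/allP => _ /mapP[i _ ->]; exact: (Sz i.+1).1.
apply/(pathP 0%N) => i; rewrite size_moves => lin.
rewrite nth_cons_moves; last exact: ltnW.
by rewrite nth_mkseq//; exact: (Sz i).2.
Qed.

Lemma cylinder_moves n z : Sigma M z -> cylinder M (z 0%N :: moves n z) z.
Proof.
move=> Sz; split=> // i; rewrite /= size_moves => lin.
by rewrite nth_cons_moves.
Qed.

Lemma moves_cylinder x w z : cylinder M (x :: w) z ->
  z 0%N = x /\ moves (size w) z = w.
Proof.
move=> [_ zw]; split; first exact: (zw 0%N).
apply: (@eq_from_nth _ 0%N); rewrite size_moves// => i iw.
by rewrite nth_mkseq// (zw i.+1).
Qed.

Lemma iter_shift n z i : iter n shiftmap z i = z (n + i)%N.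
Proof. by elim: n i => [//|n IH] i; rewrite iterS /shiftmap IH addnS addSn. Qed.

Lemma Sigma_shift n z : Sigma M z -> Sigma M (iter n shiftmap z).
Proof. by move=> Sz i; rewrite !iter_shift addnS; exact: Sz. Qed.

Lemma cylinder_shift x w1 w2 z : cylinder M (x :: w1 ++ w2) z ->
  cylinder M (last x w1 :: w2) (iter (size w1) shiftmap z).
Proof.
move=> [Sz zw]; split; first exact: Sigma_shift.
move=> i; rewrite /= ltnS => iw; rewrite iter_shift zw; last first.
  by rewrite /= size_cat ltnS leq_add2l.
case: i iw => [|i] iw.
  by rewrite addn0 -cat_cons nth_cat/= ltnSn (last_nth 0%N).
by rewrite addnS /= nth_cat ltnNge leq_addr/= addKn.
Qed.

Lemma cylinder_catl x w1 w2 : cylinder M (x :: w1 ++ w2) `<=` cylinder M (x :: w1).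
Proof.
move=> z [Sz zw]; split=> // i iw; rewrite zw; last first.
  by apply: leq_trans iw _; rewrite /= size_cat ltnS leq_addr.
by rewrite -cat_cons nth_cat iw.
Qed.

Hypothesis Mtrans : transitive_shift M.

Lemma Sigma_through x : (0 < x)%N -> exists z, Sigma M z /\ z 0%N = x.
Proof.
move=> x0; have [N [_ [z [[Sz zx] _]]]] := Mtrans x0 x0.
by exists z; split=> //; exact: (zx 0%N).
Qed.

Lemma walk_exists x y : (0 < x)%N -> (0 < y)%N ->
  exists2 w, walk x y w & w != [::].
Proof.
move=> x0 y0; have [N [N0 [z [[Sz zx] [_ zy]]]]] := Mtrans x0 y0.
exists (moves N z); last by rewrite -size_eq0 size_moves -lt0n.
have <- : z 0%N = x by exact: (zx 0%N).
have <- : z N = y by have := zy 0%N isT; rewrite iter_shift addn0.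
exact: walk_moves.
Qed.

Lemma cylinder_neq0 x y w : walk x y w -> cylinder M (x :: w) !=set0.
Proof.
move=> xyw; have [z [Sz z0]] := Sigma_through (walk_tgt xyw).
case: xyw => /andP[w0 pw] lw.
exists (fun i => if (i < size w)%N then nth 0%N (x :: w) i else z (i - size w)%N).
have nthw i : (i <= size w)%N ->
  (if (i < size w)%N then nth 0%N (x :: w) i else z (i - size w)%N)
   = nth 0%N (x :: w) i.
  rewrite leq_eqVlt => /orP[/eqP ->|->//].
  by rewrite ltnn subnn z0 -lw (last_nth 0%N).
split; last by move=> i iw; rewrite nthw.
move=> i; have [iw|wi] := ltnP i (size w); last first.
  by rewrite [(i.+1 < _)%N]ltnNge (leqW wi)/= subSn//; exact: Sz.
split; first by move/allP: w0; apply; rewrite mem_nth//= ltnW.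
by rewrite nthw//=; exact: (pathP 0%N pw).
Qed.

End Walks.

Section BoundedDistortion.
Variables (R : realType) (M : rel nat).
Implicit Types (phi : (nat -> nat) -> R) (K : R).

(** Points are compared when they agree on one letter more than the number of
    summands: the shifted points then share at least two letters, and the
    first variation, which may be infinite, never enters. *)
Definition bounded_distortion phi K : Prop :=
  1 <= K /\ forall n x y, Sigma M x -> Sigma M y ->
    (forall i, (i <= n)%N -> x i = y i) ->
    expR (birkhoff shiftmap phi n x) <= K * expR (birkhoff shiftmap phi n y).

(** The [i]-th of [n] summands changes by at most the variation of order
    [n + 1 - i], and these orders are distinct numbers from 2 on. *)
Lemma summable_variations_distortion phi : Sigma M !=set0 ->
  summable_variations M phi -> exists K, bounded_distortion phi K.
Proof.
move=> [z Sz] var_fin.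
have var0 k : (0 <= varn M phi k)%E.
  by apply: ereal_sup_ubound; exists z, z; split=> //; rewrite subrr normr0.
have sum0 : (0 <= \sum_(2 <= k <oo) varn M phi k)%E by apply: nneseries_ge0.
have fin : (\sum_(2 <= k <oo) varn M phi k)%E \is a fin_num.
  by rewrite ge0_fin_numE.
exists (expR (fine (\sum_(2 <= k <oo) varn M phi k)%E)); split.
  by rewrite -expR0 ler_expR fine_ge0.
move=> n x y Sx Sy xy; rewrite -expRD ler_expR -lerBlDr -lee_fin fineK//.
rewrite /birkhoff -sumrB -sumEFin.
apply: (@le_trans _ _ (\sum_(0 <= i < n) varn M phi (n.+1 - i))%E).
  rewrite big_nat [leRHS]big_nat; apply: lee_sum => i /andP[_ lin].
  apply: (@le_trans _ _ `|phi (iter i shiftmap x) - phi (iter i shiftmap y)|%:E).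
    by rewrite lee_fin ler_norm.
  apply: ereal_sup_ubound; exists (iter i shiftmap x), (iter i shiftmap y).
  split=> //; [exact: Sigma_shift|exact: Sigma_shift|].
  by move=> j jn; rewrite !iter_shift xy//; move: jn lin; lia.
apply: (@le_trans _ _ (\sum_(2 <= k < n + 2) varn M phi k)%E); last first.
  by apply: nneseries_lim_ge.
rewrite big_nat_rev/= -{1}[2%N]add0n big_addn addnK big_nat [leRHS]big_nat.
rewrite le_eqVlt; apply/orP; left; apply/eqP; apply: eq_bigr => i /andP[_ lin].
by congr varn; move: lin; lia.
Qed.

Lemma zero_distortion : bounded_distortion (fun _ => 0) 1.
Proof. by split=> // n x y _ _ _; rewrite mul1r /birkhoff !big1. Qed.

End BoundedDistortion.

Section Weights.
Variables (R : realType) (M : rel nat).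
Implicit Types (wt : nat -> seq nat -> R) (K p : R).

(** Weights of walks that are multiplicative under concatenation up to a fixed
    factor: all that the argument retains of a potential with summable
    variations. *)
Record quasi_multiplicative wt K : Prop := QuasiMultiplicative {
  qm_const : 1 <= K ;
  qm_gt0 : forall x w, 0 < wt x w ;
  qm_le : forall x y z w1 w2, walk M x y w1 -> walk M y z w2 ->
    wt x (w1 ++ w2) <= K * (wt x w1 * wt y w2) ;
  qm_ge : forall x y z w1 w2, walk M x y w1 -> walk M y z w2 ->
    wt x w1 * wt y w2 <= K * wt x (w1 ++ w2) }.

Definition tilt p wt : nat -> seq nat -> R :=
  fun x w => wt x w * expR (p * (size w)%:R).

Lemma quasi_multiplicative_tilt p wt K :
  quasi_multiplicative wt K -> quasi_multiplicative (tilt p wt) K.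
Proof.
move=> [K1 wt0 wtle wtge]; split=> //.
- by move=> x w; rewrite mulr_gt0// expR_gt0.
- move=> x y z w1 w2 h1 h2; rewrite /tilt size_cat natrD mulrDr expRD.
  rewrite [in leRHS]mulrACA [leRHS]mulrA.
  by apply: ler_wpM2r; [rewrite mulr_ge0 ?expR_ge0|exact: wtle h1 h2].
- move=> x y z w1 w2 h1 h2; rewrite /tilt size_cat natrD mulrDr expRD.
  rewrite mulrACA [leRHS]mulrA.
  by apply: ler_wpM2r; [rewrite mulr_ge0 ?expR_ge0|exact: wtge h1 h2].
Qed.

Definition total wt (x : nat) (D : set (seq nat)) : \bar R :=
  (\esum_(w in D) (wt x w)%:E)%E.

(** An arbitrary point of the cylinder stands for all of them; by bounded
    distortion the choice matters only up to a constant factor. *)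
Definition weight (phi : (nat -> nat) -> R) (x : nat) (w : seq nat) : R :=
  expR (birkhoff shiftmap phi (size w) (xget (fun=> 0%N) (cylinder M (x :: w)))).

Hypothesis Mtrans : transitive_shift M.

Lemma birkhoffD phi m n z : birkhoff shiftmap phi (m + n) z =
  birkhoff shiftmap phi m z + birkhoff shiftmap phi n (iter m shiftmap z) :> R.
Proof.
rewrite /birkhoff (@big_cat_nat _ _ _ m)//= ?leq_addr//; congr (_ + _).
rewrite -{1}[m]add0n big_addn addKn; apply: eq_bigr => i _.
by rewrite -iterD.
Qed.

Section Distortion.
Variables (phi : (nat -> nat) -> R) (K : R).
Hypothesis dist : bounded_distortion M phi K.

Lemma weight_point_ge x w z : cylinder M (x :: w) z ->
  expR (birkhoff shiftmap phi (size w) z) <= K * weight phi x w.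
Proof.
move=> zw; have [Sx ew] : cylinder M (x :: w) (xget (fun=> 0%N) (cylinder M (x :: w))).
  by apply: xgetPex; exists z.
case: zw => Sz zw; apply: dist.2 => // i iw.
by rewrite ew ?zw.
Qed.

Lemma weight_point_le x w z : cylinder M (x :: w) z ->
  weight phi x w <= K * expR (birkhoff shiftmap phi (size w) z).
Proof.
move=> zw; have [Sx ew] : cylinder M (x :: w) (xget (fun=> 0%N) (cylinder M (x :: w))).
  by apply: xgetPex; exists z.
case: zw => Sz zw; apply: dist.2 => // i iw.
by rewrite ew ?zw.
Qed.

(** The Birkhoff sum over a concatenated walk splits exactly; replacing the
    representative of the whole by those of the two parts costs [K] twice. *)
Lemma quasi_multiplicative_weight :
  quasi_multiplicative (weight phi) (K ^+ 2).
Proof.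
have K1 := dist.1; have K0 : 0 <= K by apply: le_trans K1.
split=> [|x w|x y z w1 w2 h1 h2|x y z w1 w2 h1 h2].
- by rewrite expr_ge1.
- exact: expR_gt0.
- have h := walk_cat h1 h2; have [u uw] := cylinder_neq0 Mtrans h.
  have ue : cylinder M (x :: w1 ++ w2) (xget (fun=> 0%N) (cylinder M (x :: w1 ++ w2))).
    by apply: xgetPex; exists u.
  rewrite {1}/weight size_cat birkhoffD expRD expr2 mulrACA.
  apply: ler_pM; rewrite ?expR_ge0//; apply: weight_point_ge.
    exact: cylinder_catl ue.
  by have := cylinder_shift ue; case: h1 => _ ->.
- have h := walk_cat h1 h2; have [u uw] := cylinder_neq0 Mtrans h.
  have ue : cylinder M (x :: w1 ++ w2) (xget (fun=> 0%N) (cylinder M (x :: w1 ++ w2))).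
    by apply: xgetPex; exists u.
  rewrite [in leRHS]/weight size_cat birkhoffD expRD expr2 mulrACA.
  apply: ler_pM; rewrite ?expR_ge0//; apply: weight_point_le.
    exact: cylinder_catl ue.
  by have := cylinder_shift ue; case: h1 => _ ->.
Qed.

End Distortion.
End Weights.

(** * Concatenation of sets of walks *)

Definition concat_pow (A : set (seq nat)) : nat -> set (seq nat) :=
  fix pow k := if k is k'.+1 then [set v ++ w | v in A & w in pow k']
               else [set [::]].

Definition excursion (M : rel nat) (F : seq nat) (x y : nat) : set (seq nat) :=
  [set w | walk M x y w /\
           exists2 u, w = rcons u y & all (fun l => l \notin F) u].

(** [first_loop M b] is the set of first return loops at [b]. *)
Definition first_loop (M : rel nat) (b : nat) : set (seq nat) :=
  excursion M [:: b] b b.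

Section Concatenation.
Variables (R : realType) (M : rel nat) (wt : nat -> seq nat -> R) (K : R).
Hypothesis qm : quasi_multiplicative M wt K.
Implicit Types (A B D : set (seq nat)) (F : seq nat).

Let K1 : 1 <= K := qm_const qm.
Let K0 : 0 < K := lt_le_trans ltr01 K1.
Let K_ge0 : 0 <= K := ltW K0.
Let wt0 x w : 0 < wt x w := qm_gt0 qm x w.
Let wt_ge0 x w : 0 <= wt x w := ltW (wt0 x w).

Lemma total_ge0 x D : (0 <= total wt x D)%E.
Proof. by apply: esum_ge0 => w _; rewrite lee_fin. Qed.

Lemma total_finite x D : (total wt x D < +oo)%E ->
  exists2 a : R, 0 <= a & total wt x D = a%:E.
Proof.
move=> Doo; have D0 := total_ge0 x D.
exists (fine (total wt x D)); first by rewrite fine_ge0.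
by rewrite fineK// ge0_fin_numE.
Qed.

Lemma total_cat_le x y A B D (a b : R) :
  A `<=` walk M x y -> (forall w, B w -> exists z, walk M y z w) ->
  D `<=` [set w1 ++ w2 | w1 in A & w2 in B] ->
  (total wt x A <= a%:E)%E -> (total wt y B <= b%:E)%E ->
  (total wt x D <= (K * (a * b))%:E)%E.
Proof.
move=> Axy By DAB Aa Bb; have b0 : 0 <= b.
  by rewrite -lee_fin; apply: le_trans (total_ge0 _ _) Bb.
apply: (@le_trans _ _ (\esum_(w1 in A) \esum_(w2 in B) (wt x (w1 ++ w2))%:E)%E).
  rewrite esum_esum//; last by move=> *; rewrite lee_fin.
  apply: (le_esum_surj (e := fun u => u.1 ++ u.2)
    (f := fun w => (wt x w)%:E)) => [w _|w /DAB[w1 Aw1 [w2 Bw2 <-]]].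
    by rewrite lee_fin.
  by exists (w1, w2).
apply: (@le_trans _ _ (\esum_(w1 in A) ((K * b)%:E * (wt x w1)%:E))%E).
  apply: le_esum => w1 Aw1.
  apply: (@le_trans _ _ (\esum_(w2 in B) ((K * wt x w1)%:E * (wt y w2)%:E))%E).
    apply: le_esum => w2 /By[z yz]; rewrite -EFinM lee_fin -mulrA.
    exact: qm_le qm _ _ _ _ _ (Axy _ Aw1) yz.
  rewrite esumZl ?mulr_ge0//; last by move=> *; rewrite lee_fin.
  apply: (@le_trans _ _ ((K * wt x w1)%:E * b%:E)%E).
    by apply: lee_wpmul2l => //; rewrite lee_fin mulr_ge0.
  by rewrite -!EFinM lee_fin; nra.
rewrite esumZl ?mulr_ge0//; last by move=> *; rewrite lee_fin.
apply: (@le_trans _ _ ((K * b)%:E * a%:E)%E).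
  by apply: lee_wpmul2l => //; rewrite lee_fin mulr_ge0.
by rewrite -!EFinM lee_fin; nra.
Qed.

Lemma wt_nil_le b : (0 < b)%N -> wt b [::] <= K.
Proof.
move=> b0; have h := walk_nil M b0.
by have := qm_ge qm h h; rewrite cats0 ler_pM2r.
Qed.

Lemma concat_pow_walk A b k : (0 < b)%N -> A `<=` walk M b b ->
  concat_pow A k `<=` walk M b b.
Proof.
move=> b0 Ab; elim: k => [|k IH] w /=; first by move=> ->; exact: walk_nil.
by move=> [v Av [u Au <-]]; apply: walk_cat (Ab _ Av) (IH _ Au).
Qed.

Lemma total_concat_pow A b k (a : R) : (0 < b)%N -> A `<=` walk M b b ->
  (total wt b A <= a%:E)%E ->
  (total wt b (concat_pow A k) <= (K * (K * a) ^+ k)%:E)%E.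
Proof.
move=> b0 Ab Aa; elim: k => [|k IH].
  rewrite expr0 mulr1 /total esum_set1 ?lee_fin//; exact: wt_nil_le.
apply: (@le_trans _ _ (K * (a * (K * (K * a) ^+ k)))%:E)%E.
  apply: (total_cat_le Ab _ _ Aa IH) => //.
  by move=> w /(concat_pow_walk b0 Ab) h; exists b.
by rewrite lee_fin exprS le_eqVlt; apply/orP; left; apply/eqP; ring.
Qed.

(** The factor lost by inserting a loop [g] depends on [g] but not on the walk:
    split the walk, append [g] to the first half, and join again. *)
Lemma total_insert x y b u g w :
  walk M x b u -> walk M b b g -> walk M b y w ->
  wt b g / K ^+ 3 * wt x (u ++ w) <= wt x (u ++ g ++ w).
Proof.
move=> hu hg hw; rewrite mulrAC ler_pdivrMr ?exprn_gt0//.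
have h1 := qm_le qm hu hw; have h2 := qm_ge qm hu hg.
have h3 := qm_ge qm (walk_cat hu hg) hw.
rewrite -catA in h3.
have g0 := wt0 b g; have w0 := wt0 b w.
apply: (@le_trans _ _ (wt b g * (K * (wt x u * wt b w)))); first by rewrite ler_wpM2l.
apply: (@le_trans _ _ (K * (K * wt x (u ++ g) * wt b w))).
  have -> : wt b g * (K * (wt x u * wt b w)) = K * (wt x u * wt b g * wt b w) by ring.
  by rewrite ler_pM2l// ler_wpM2r.
have -> : wt x (u ++ g ++ w) * K ^+ 3 = K * (K * (K * wt x (u ++ g ++ w))) by ring.
by rewrite ler_pM2l// -mulrA ler_pM2l.
Qed.

End Concatenation.

Section PrefixCode.
Variables (M : rel nat).
Implicit Types (F : seq nat).

Lemma excursion_walk F x y : excursion M F x y `<=` walk M x y.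
Proof. by move=> w []. Qed.

(** Excursions to a letter of [F] form a prefix code, because such a word ends
    at its first visit to [F]. *)
Lemma excursion_prefix F x y v v' w w' : y \in F ->
  excursion M F x y v -> excursion M F x y v' -> v ++ w = v' ++ w' ->
  v = v' /\ w = w'.
Proof.
move=> yF [_ [u -> uF]] [_ [u' -> u'F]] e.
have idx (s t : seq nat) : all (fun l => l \notin F) s ->
    index y (rcons s y ++ t) = size s.
  move=> sF; rewrite cat_rcons index_cat ifF /= ?eqxx ?addn0//.
  by apply/negP => /(allP sF); rewrite yF.
have su : size (rcons u y) = size (rcons u' y).
  by rewrite !size_rcons -(idx _ w uF) -(idx _ w' u'F) e.
by move/eqP: e; rewrite eqseq_cat// => /andP[/eqP ? /eqP ?].
Qed.

End PrefixCode.

(** * Forbidding a loop lowers the growth rate *)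

Section ForbiddenLoop.
Variables (R : realType) (M : rel nat) (wt : nat -> seq nat -> R) (K : R).
Hypothesis qm : quasi_multiplicative M wt K.
Variables (b : nat) (A : set (seq nat)) (g : seq nat).
Hypotheses (Ab : A `<=` first_loop M b) (gb : first_loop M b g) (Ag : ~ A g).

Let wt_ge0 x w : 0 <= wt x w := ltW (qm_gt0 qm x w).
Let Aw : A `<=` walk M b b := subset_trans Ab (@excursion_walk M [:: b] b b).
Let gw : walk M b b g := excursion_walk gb.
Let b0 : (0 < b)%N := walk_src gw.

(** The optional loop is attached to a block instead of being placed freely, so
    that each slot receives it at most once and parsing is unambiguous. *)
Definition with_optional_loop : set (seq nat) :=
  [set v | A v] `|` [set v ++ g | v in A].

Definition decorated := concat_pow with_optional_loop.

Let opt (s : bool) := if s then g else [::].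

Lemma decorated_walk k : decorated k `<=` walk M b b.
Proof.
apply: concat_pow_walk => // w [/Aw//|[v /Aw h <-]].
exact: walk_cat h gw.
Qed.

(** A decorated word determines its decorations: the first return loops that
    compose a loop at [b] are unique, and [g] is not one of the blocks. *)
Lemma decorated_parse k s s' v v' w w' : A v -> A v' ->
  decorated k w -> decorated k w' ->
  v ++ opt s ++ w = v' ++ opt s' ++ w' -> [/\ v = v', s = s' & w = w'].
Proof.
move=> Av Av' kw kw' /(excursion_prefix (mem_head _ _) (Ab Av) (Ab Av'))[-> e].
have nog t t' : decorated k t' -> g ++ t = t' -> False.
  case: k {kw kw'} => [|k]; rewrite /decorated/=.
    move=> -> /(congr1 size); case: gb => _ [u -> _].
    by rewrite size_cat size_rcons.
  move=> [z [Az|[z0 Az <-]] [z' _ <-]] gt; apply: Ag.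
    by have [-> _] := excursion_prefix (mem_head _ _) gb (Ab Az) gt.
  rewrite -catA in gt.
  by have [-> _] := excursion_prefix (mem_head _ _) gb (Ab Az) gt.
case: s s' e => [] [] /= e.
- by have [_ ->] := excursion_prefix (mem_head _ _) gb gb e.
- by case: (nog _ _ kw' e).
- by case: (nog _ _ kw (esym e)).
- by [].
Qed.

Let kappa := wt b g / K ^+ 3.
Let kappa0 : 0 < kappa.
Proof.
rewrite /kappa divr_gt0 ?(qm_gt0 qm)// exprn_gt0//.
exact: lt_le_trans ltr01 (qm_const qm).
Qed.

(** The prefix [u] already built is carried along, so that the distortion
    constant is paid only when [g] is inserted and not for each of the [k]
    blocks; otherwise it could outweigh the gain [1 + kappa]. *)
Lemma total_decorated k u : walk M b b u ->
  (((1 + kappa) ^+ k)%:E * (\esum_(w in concat_pow A k) (wt b (u ++ w))%:E) <=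
   \esum_(w in decorated k) (wt b (u ++ w))%:E)%E.
Proof.
have wtE0 x w : (0 <= (wt x w)%:E)%E by rewrite lee_fin.
have k1 : 0 <= 1 + kappa by rewrite addr_ge0// ltW.
elim: k u => [|k IH] u hu; first by rewrite expr0 mul1e.
pose S D v := (\esum_(w in D) (wt b (v ++ w))%:E)%E.
have S0 D v : (0 <= S D v)%E by apply: esum_ge0.
apply: (@le_trans _ _ (((1 + kappa) ^+ k.+1)%:E *
    (\esum_(v in A) S (concat_pow A k) (u ++ v)))%E).
  apply: lee_wpmul2l; first by rewrite lee_fin exprn_ge0.
  rewrite /S esum_esum//.
  apply: (@le_trans _ _ (\esum_(z in A `*` concat_pow A k) (wt b (u ++ (z.1 ++ z.2)))%:E)%E).
    apply: (le_esum_surj (e := fun z : seq nat * seq nat => z.1 ++ z.2)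
      (f := fun w => (wt b (u ++ w))%:E)) => // w [v Av [w' kw' <-]].
    by exists (v, w').
  by apply: le_esum => z _; rewrite catA.
rewrite -esumZl ?exprn_ge0//.
apply: (@le_trans _ _ (\esum_(v in A)
    (S (decorated k) (u ++ v) + S (decorated k) (u ++ v ++ g)))%E).
  apply: le_esum => v Av; have hv := Aw Av; have huv := walk_cat hu hv.
  have hg := walk_cat hu (walk_cat hv gw).
  apply: (@le_trans _ _ (((1 + kappa) ^+ k)%:E * S (concat_pow A k) (u ++ v)
      + ((1 + kappa) ^+ k)%:E * (kappa%:E * S (concat_pow A k) (u ++ v)))%E).
    rewrite -ge0_muleDr ?mule_ge0 ?lee_fin ?(ltW kappa0)//.
    rewrite -{2}(mul1e (S _ _)) -ge0_muleDl ?lee_fin ?(ltW kappa0)//.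
    by rewrite muleA -EFinD -EFinM exprSr.
  apply: leeD; first exact: IH.
  apply: le_trans (IH _ hg); apply: lee_wpmul2l; first by rewrite lee_fin exprn_ge0.
  rewrite -esumZl ?(ltW kappa0)//; apply: le_esum => w /(concat_pow_walk b0 Aw) hw.
  by rewrite -EFinM lee_fin; have := total_insert qm huv gw hw; rewrite -!catA.
pose D := [set z.1 ++ z.2 | z in A `*` decorated k].
rewrite esumD// [leRHS](esumID D)// /S !esum_esum//; apply: leeD.
  apply: (@le_trans _ _ (\esum_(z in A `*` decorated k) (wt b (u ++ (z.1 ++ z.2)))%:E)%E).
    by apply: le_esum => z _; rewrite catA.
  apply: (le_esum_inj (e := fun z : seq nat * seq nat => z.1 ++ z.2)
      (fun w => (wt b (u ++ w))%:E)).
    move=> [v w] [v' w'] /[!inE] -[/= Av kw] [/= Av' kw'] e.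
    by have [-> _ ->] := @decorated_parse k false false _ _ _ _ Av Av' kw kw' e.
  move=> _ [[v w] [/= Av kw] <-]; split; last by exists (v, w).
  by exists v; [left|exists w].
apply: (@le_trans _ _ (\esum_(z in A `*` decorated k) (wt b (u ++ (z.1 ++ g ++ z.2)))%:E)%E).
  by apply: le_esum => z _; rewrite !catA.
apply: (le_esum_inj (e := fun z : seq nat * seq nat => z.1 ++ g ++ z.2)
      (fun w => (wt b (u ++ w))%:E)).
  move=> [v w] [v' w'] /[!inE] -[/= Av kw] [/= Av' kw'] e.
  by have [-> _ ->] := @decorated_parse k true true _ _ _ _ Av Av' kw kw' e.
move=> _ [[v w] [/= Av kw] <-]; split.
  by exists (v ++ g); [right; exists v|exists w; rewrite -?catA].
move=> [[v' w'] [/= Av' kw'] e].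
by have [] := @decorated_parse k false true _ _ _ _ Av' Av kw' kw e.
Qed.

Lemma total_forbidden_loop k :
  (((1 + kappa) ^+ k)%:E * total wt b (concat_pow A k) <= total wt b (walk M b b))%E.
Proof.
apply: le_trans (total_decorated k (walk_nil M b0)) _.
exact/le_esum_set/decorated_walk.
Qed.

End ForbiddenLoop.

Section Subcritical.
Variables (R : realType) (M : rel nat) (wt : nat -> seq nat -> R) (K : R).
Hypothesis qm : quasi_multiplicative M wt K.

Let wt_ge0 x w : 0 <= wt x w := ltW (qm_gt0 qm x w).

Lemma total_tilt_le p p' x D : p <= p' ->
  (total (tilt p wt) x D <= total (tilt p' wt) x D)%E.
Proof.
move=> pp'; apply: le_esum => w _; rewrite lee_fin ler_wpM2l// ler_expR.
by rewrite ler_wpM2r.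
Qed.

(** Walks shorter than [l] gain little when the tilt grows from [p1] to [p];
    longer ones are dominated by the tilt [p0]. *)
Lemma tilt_interpolation (p0 p1 p l : R) x w : p1 <= p -> p <= p0 ->
  tilt p wt x w <= expR (l * (p - p1)) * tilt p1 wt x w
                   + expR (- (l * (p0 - p))) * tilt p0 wt x w.
Proof.
move=> p1p pp0; rewrite /tilt !(mulrCA _ (wt x w)) -mulrDr ler_wpM2l//.
rewrite -!expRD; have [nl|/ltW ln] := leP (size w)%:R l.
  apply: ler_wpDr; first exact: expR_ge0.
  have : 0 <= (l - (size w)%:R) * (p - p1) by rewrite mulr_ge0// subr_ge0.
  by rewrite ler_expR; lra.
apply: ler_wpDl; first exact: expR_ge0.
have : 0 <= ((size w)%:R - l) * (p0 - p) by rewrite mulr_ge0// subr_ge0.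
by rewrite ler_expR; lra.
Qed.

(** Below [pc] the sums over concatenations of [k] blocks of [A] decay like
    [(1 + k0) ^- k], uniformly near [pc], by the forbidden loop [g]. At [p0]
    they grow at most like [(K * a) ^+ k], where [a] is the sum over [A].
    Interpolating with the length
    threshold [L * k] transfers the decay to some [p] above [pc]. *)
Lemma subcritical_without_loop b A g (pc p0 : R) :
  A `<=` first_loop M b -> first_loop M b g -> ~ A g -> pc < p0 ->
  (forall p, p < pc -> (total (tilt p wt) b (walk M b b) < +oo)%E) ->
  (total (tilt p0 wt) b A < +oo)%E ->
  exists2 p, pc < p <= p0 &
    (total (tilt p wt) b (\bigcup_k concat_pow A k) < +oo)%E.
Proof.
move=> Ab gb Ag pcp0 sub Afin.
have K1 := qm_const qm; have K0 : 0 < K := lt_le_trans ltr01 K1.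
have qmt p := quasi_multiplicative_tilt p qm.
have [a a0 Za] := total_finite (qmt p0) Afin.
have Aw : A `<=` walk M b b := subset_trans Ab (@excursion_walk M [:: b] b b).
have b0 : (0 < b)%N := walk_src (excursion_walk gb).
pose t := (p0 - pc) / 2; have t0 : 0 < t by rewrite divr_gt0// subr_gt0.
have Ka0 : 0 <= K * a by rewrite mulr_ge0// ltW.
(* Makes [expR (- (L * t)) * (K * a)] at most one half: walks of more than
   [L * k] steps then contribute at most [K * 2 ^- k] at [p]. *)
pose L := ln (2 * (K * a) + 2) / t.
have lnL : 0 < ln (2 * (K * a) + 2) by rewrite ln_gt0//; lra.
have L0 : 0 < L by rewrite divr_gt0.
(* The gain per block at the tilt [pc - 1] serves for all tilts between
   [pc - 1] and [pc], which is why [h] is taken at most 1. *)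
pose k0 := tilt (pc - 1) wt b g / K ^+ 3.
have k00 : 0 < k0 by rewrite divr_gt0 ?exprn_gt0// (qm_gt0 (qmt _)).
have lnk : 0 < ln (1 + k0 / 2) by rewrite ln_gt0//; lra.
pose h := Num.min (Num.min 1 t) (ln (1 + k0 / 2) / L).
have h0 : 0 < h by rewrite /h !lt_min ltr01 t0/= divr_gt0.
have h1 : h <= 1 by rewrite /h !ge_min lexx.
have ht : h <= t by rewrite /h !ge_min lexx !orbT.
have hL : L * h <= ln (1 + k0 / 2).
  by rewrite mulrC -ler_pdivlMr// /h ge_min lexx orbT.
have tE : t = (p0 - pc) / 2 by [].
(* By the choice of [h], walks of at most [L * k] steps gain at most
   [(1 + k0 / 2) ^+ k] between [p1] and [p], less than the decay at [p1]. *)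
pose p := pc + h / 2; pose p1 := pc - h / 2.
have p1c : p1 < pc by rewrite /p1; lra.
exists p; first by rewrite /p; apply/andP; split; lra.
have [G G0 ZG] := total_finite (qmt p1) (sub _ p1c).
pose r := Num.max (2^-1) ((1 + k0 / 2) / (1 + k0)).
have r0 : 0 <= r by rewrite /r le_max invr_ge0 ler0n.
have r1 : r < 1.
  by rewrite /r gt_max invf_lt1// ltr1n/= ltr_pdivrMr; lra.
have step k : (total (tilt p wt) b (concat_pow A k) <= ((G + K) * r ^+ k)%:E)%E.
  pose l := L * k%:R.
  pose c1 := expR (l * (p - p1)); pose c0 := expR (- (l * (p0 - p))).
  apply: (@le_trans _ _ (c1%:E * total (tilt p1 wt) b (concat_pow A k)
      + c0%:E * total (tilt p0 wt) b (concat_pow A k)))%E.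
    rewrite /total -!esumZl ?expR_ge0//;
      try by move=> w _; rewrite lee_fin (ltW (qm_gt0 (qmt _) _ _)).
    rewrite -esumD; try by move=> w _;
      rewrite -EFinM lee_fin mulr_ge0 ?expR_ge0// (ltW (qm_gt0 (qmt _) _ _)).
    apply: le_esum => w _; rewrite -!EFinM -EFinD lee_fin.
    by apply: tilt_interpolation; rewrite /p /p1; lra.
  rewrite mulrDl EFinD; apply: leeD.
    pose kk := tilt p1 wt b g / K ^+ 3.
    have kk0 : k0 <= kk.
      rewrite /k0 /kk ler_wpM2r ?invr_ge0 ?exprn_ge0 ?(ltW K0)//.
      by rewrite /tilt ler_wpM2l// ler_expR ler_wpM2r// /p1; lra.
    have kk1 : 0 < (1 + kk) ^+ k by rewrite exprn_gt0//; lra.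
    have := total_forbidden_loop (qmt p1) Ab gb Ag k; rewrite ZG -/kk => ub.
    have c1r : c1 / (1 + kk) ^+ k <= r ^+ k.
      have -> : c1 = expR (L * h) ^+ k.
        by rewrite -expRM_natr /c1 /l; congr expR; rewrite /p /p1; field.
      rewrite -expr_div_n; apply: lerXn2r; rewrite ?nnegrE// ?divr_ge0 ?expR_ge0//.
        lra.
      apply: (@le_trans _ _ ((1 + k0 / 2) / (1 + k0))); last first.
        by rewrite /r le_max lexx orbT.
      apply: ler_pM; rewrite ?expR_ge0 ?invr_ge0//; first lra.
        by rewrite -ler_ln ?posrE ?expR_gt0 ?expRK//; lra.
      by rewrite lef_pV2 ?posrE; lra.
    apply: (@le_trans _ _ (c1 / (1 + kk) ^+ k * G)%:E).
      rewrite !EFinM -muleA; apply: lee_wpmul2l; first by rewrite lee_fin expR_ge0.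
      rewrite -(@lee_pmul2l _ ((1 + kk) ^+ k)%:E) ?lte_fin//.
      by apply: le_trans ub _; rewrite -!EFinM mulrA divff ?gt_eqF// mul1r.
    by rewrite lee_fin mulrC ler_wpM2l.
  have Zk := total_concat_pow (qmt p0) k b0 Aw (_ : _ <= a%:E)%E.
  apply: (@le_trans _ _ (c0%:E * (K * (K * a) ^+ k)%:E)%E).
    apply: lee_wpmul2l; first by rewrite lee_fin expR_ge0.
    by apply: Zk; rewrite Za.
  rewrite -EFinM lee_fin mulrCA ler_wpM2l ?(ltW K0)//.
  apply: (@le_trans _ _ (expR (- (L * t)) ^+ k * (K * a) ^+ k)).
    rewrite ler_wpM2r ?exprn_ge0// -expRM_natr ler_expR /l.
    have tp : t <= p0 - p by rewrite /p; lra.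
    have : 0 <= L * k%:R * (p0 - p - t).
      apply: mulr_ge0; last by rewrite subr_ge0.
      by apply: mulr_ge0; [exact: ltW|exact: ler0n].
    by lra.
  rewrite -exprMn; apply: lerXn2r; rewrite ?nnegrE ?mulr_ge0 ?expR_ge0 ?(ltW K0)//.
  apply: (@le_trans _ _ (2^-1)); last by rewrite /r le_max lexx.
  rewrite /L divfK ?gt_eqF// expRN lnK ?posrE; last lra.
  by rewrite mulrC ler_pdivrMr; lra.
apply: le_lt_trans (esum_bigcup_le _ (@subset_refl _ _)) _.
  by move=> w; rewrite lee_fin (ltW (qm_gt0 (qmt _) _ _)).
apply: (nneseries_geometric_lty (n0 := 0) (C := G + K) (r := r)) => //.
- by move=> k; apply: (total_ge0 (qmt p)).
- by move=> k; apply: le_lt_trans (step k) (ltry _).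
- by rewrite addr_ge0// ltW.
- by rewrite r0.
- by move=> k _; exact: step.
Qed.

End Subcritical.

(** * Eliminating letters from a finite set *)

Section ExcursionWords.
Variables (M : rel nat) (Mtrans : transitive_shift M).
Implicit Types (F : seq nat) (w : seq nat).

Lemma excursion_first_hit F x y b w : excursion M F x y w ->
  excursion M (b :: F) x y w \/
  exists w1 w2, [/\ excursion M (b :: F) x b w1, excursion M F b y w2 &
                    w = w1 ++ w2].
Proof.
move=> [hw [u uE uF]]; have [bu|bu] := boolP (b \in u); last first.
  left; split=> //; exists u => //; apply/allP => l lu.
  rewrite inE negb_or (allP uF _ lu) andbT.
  by apply: contraNneq bu => <-.
right; move: bu; rewrite -has_pred1 => bu.
move: hw uF uE; case: (split_find bu) => _ s1 s2 /eqP -> s1b hw.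
rewrite all_cat all_rcons => /andP[/andP[bF s1F] s2F] uE.
rewrite {}uE rcons_cat in hw *; have [h1 h2] := walk_split hw.
rewrite last_rcons in h1 h2.
exists (rcons s1 b), (rcons s2 y); split=> //.
- split=> //; exists s1 => //; apply/allP => l ls1.
  rewrite inE negb_or (allP s1F _ ls1) andbT.
  by apply: contraNneq s1b => <-; rewrite has_pred1.
- by split=> //; exists s2.
Qed.

Lemma excursion_parse_from F y b w : excursion M F b y w ->
  exists w1 w2, [/\ (\bigcup_k concat_pow (excursion M (b :: F) b b) k) w1,
                    excursion M (b :: F) b y w2 & w = w1 ++ w2].
Proof.
have [n] := ubnP (size w); elim: n w => [//|n IH] w wn hw.
have [hw'|[w1 [w2 [h1 h2 wE]]]] := excursion_first_hit b hw.
  by exists [::], w; split=> //; exists 0%N.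
have s1 : (0 < size w1)%N by case: h1 => _ [u -> _]; rewrite size_rcons.
have [|v1 [v2 [[k _ kv1] hv2 w2E]]] := IH w2 _ h2.
  by move: wn; rewrite wE size_cat; lia.
exists (w1 ++ v1), v2; split=> //; last by rewrite wE w2E catA.
by exists k.+1 => //; exists w1 => //; exists v1.
Qed.

Lemma walk_avoiding b c : (0 < b)%N -> (0 < c)%N ->
  exists2 w, walk M b c w & b \notin w.
Proof.
move=> b0 c0; have [w hw _] := walk_exists Mtrans b0 c0.
have [n] := ubnP (size w); elim: n w hw => [//|n IH] w hw wn.
have [bw|bw] := boolP (b \in w); last by exists w.
move: bw; rewrite -has_pred1 => bw.
move: hw wn; case: (split_find bw) => _ s1 s2 /eqP -> _ hw wn.
have [_] := walk_split hw; rewrite last_rcons => /IH; apply.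
by move: wn; rewrite size_cat size_rcons; lia.
Qed.

Lemma first_hit_exists c b : (0 < b)%N -> (0 < c)%N ->
  exists2 w, walk M c b (rcons w b) & b \notin w.
Proof.
move=> b0 c0; have [w hw w0] := walk_exists Mtrans c0 b0.
have : b \in w by case: w hw w0 => [//|a w] [_ /= <-] _; exact: mem_last.
rewrite -has_pred1 => bw; move: hw.
case: (split_find bw) => _ s1 s2 /eqP -> s1b /walk_split[h _].
by exists s1; [move: h; rewrite last_rcons|move: s1b; rewrite has_pred1].
Qed.

Lemma first_loop_through b c : (0 < b)%N -> (0 < c)%N -> b != c ->
  exists2 u, first_loop M b (rcons u b) & c \in u.
Proof.
move=> b0 c0 bc; have [w1 h1 w1b] := walk_avoiding b0 c0.
have [w2 h2 w2b] := first_hit_exists b0 c0.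
exists (w1 ++ w2).
  split; first by rewrite rcons_cat; exact: walk_cat h1 h2.
  exists (w1 ++ w2) => //; apply/allP => l.
  rewrite mem_cat inE => /orP[lw|lw]; first by apply: contraNneq w1b => <-.
  by apply: contraNneq w2b => <-.
rewrite mem_cat; case: h1 => _ cE.
by have := mem_last b w1; rewrite cE inE eq_sym (negbTE bc)/= => ->.
Qed.

Lemma excursion_first_loop F b : b \in F -> excursion M F b b `<=` first_loop M b.
Proof.
move=> bF w [hw [u wE uF]]; split=> //; exists u => //; apply/allP => l lu.
by rewrite inE; apply/eqP => lb; have := allP uF _ lu; rewrite lb bF.
Qed.

End ExcursionWords.

Section Elimination.
Variables (R : realType) (M : rel nat) (Mtrans : transitive_shift M).
Variables (wt : nat -> seq nat -> R) (K pc : R).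
Hypothesis qm : quasi_multiplicative M wt K.
Hypothesis subcritical : forall p b, p < pc -> (0 < b)%N ->
  (total (tilt p wt) b (walk M b b) < +oo)%E.

Definition excursions_converge (p : R) (F : seq nat) : Prop :=
  forall x y, x \in F -> y \in F ->
    (total (tilt p wt) x (excursion M F x y) < +oo)%E.

(** Excursions of the smaller set are those of [b :: F] together with the ones
    through [b], which factor into an excursion to [b], loops at [b] that avoid
    [F], and an excursion from [b]. The loops at [b] that avoid [F] omit a
    first return loop through [F], so they are subcritical slightly
    above [pc]. *)
Lemma eliminate_letter p0 b F : pc < p0 -> all (leq 1) (b :: F) ->
  b \notin F -> F != [::] -> excursions_converge p0 (b :: F) ->
  exists2 p, pc < p & excursions_converge p F.
Proof.
move=> pcp0 /= /andP[b0 F0] bF Fn conv.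
have [c cF] : exists c, c \in F.
  by case: F Fn {F0 bF conv} => [//|c F] _; exists c; exact: mem_head.
have bc : b != c by apply: contraNneq bF => ->.
have [u hu cu] := first_loop_through Mtrans b0 (allP F0 _ cF) bc.
set A := excursion M (b :: F) b b.
have Ab : A `<=` first_loop M b by apply: excursion_first_loop; exact: mem_head.
have Au : ~ A (rcons u b).
  move=> [_ [v /rcons_inj[<-] /allP /(_ _ cu)]].
  by rewrite inE cF orbT.
have [p /andP[pcp pp0] hp] := subcritical_without_loop qm Ab hu Au pcp0
  (fun p h => subcritical h b0) (conv b b (mem_head _ _) (mem_head _ _)).
exists p => // x y xF yF; have qmp := quasi_multiplicative_tilt p qm.
have conv_p v w : v \in b :: F -> w \in b :: F ->
    (total (tilt p wt) v (excursion M (b :: F) v w) < +oo)%E.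
  by move=> vF wF; apply: le_lt_trans (total_tilt_le qm _ _ pp0) (conv v w vF wF).
have [l l0 El] := total_finite qmp hp.
have xbF : x \in b :: F by rewrite inE xF orbT.
have ybF : y \in b :: F by rewrite inE yF orbT.
have [a a0 Ea] := total_finite qmp (conv_p x b xbF (mem_head _ _)).
have [a' a'0 Ea'] := total_finite qmp (conv_p b y (mem_head _ _) ybF).
pose T := [set w1 ++ w2 | w1 in \bigcup_k concat_pow A k
                        & w2 in excursion M (b :: F) b y].
have Lb : \bigcup_k concat_pow A k `<=` walk M b b.
  by move=> w [k _]; apply: concat_pow_walk => // v /Ab [].
have Twalk w : T w -> exists z, walk M b z w.
  by move=> [w1 /Lb h1 [w2 [h2 _] <-]]; exists y; exact: walk_cat h1 h2.
have ET : (total (tilt p wt) b T <= (K * (l * a'))%:E)%E.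
  apply: (total_cat_le qmp Lb _ (@subset_refl _ _)); rewrite ?El ?Ea'//.
  by move=> w /excursion_walk h; exists y.
have E2 : (total (tilt p wt) x
     [set w1 ++ w2 | w1 in excursion M (b :: F) x b & w2 in T]
     <= (K * (a * (K * (l * a'))))%:E)%E.
  apply: (total_cat_le qmp (@excursion_walk _ _ _ _) Twalk (@subset_refl _ _)) => //.
  by rewrite Ea.
have subT : excursion M F x y `<=` excursion M (b :: F) x y `|`
    [set w1 ++ w2 | w1 in excursion M (b :: F) x b & w2 in T].
  move=> w /(excursion_first_hit b)[|[w1 [w2 [h1 h2 ->]]]]; [by left|right].
  exists w1 => //; exists w2 => //.
  have [v1 [v2 [hv1 hv2 ->]]] := excursion_parse_from h2.
  by exists v1 => //; exists v2.
apply: le_lt_trans (esum_setU_le _ subT) _.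
- by move=> w; rewrite lee_fin ltW// (qm_gt0 qmp).
- apply: lte_add_pinfty; first exact: conv_p.
  exact: le_lt_trans E2 (ltry _).
Qed.

Lemma eliminate_letters p0 F : pc < p0 -> all (leq 1) F -> uniq F ->
  F != [::] -> excursions_converge p0 F ->
  exists a p, [/\ (0 < a)%N, pc < p & excursions_converge p [:: a]].
Proof.
elim: F p0 => [//|b F IH] p0 pcp0 F0 /= /andP[bF uF] _ conv.
have [FE|Fn] := eqVneq F [::].
  by exists b, p0; move: F0 conv; rewrite FE /= andbT.
have [p pcp conv'] := eliminate_letter pcp0 F0 bF Fn conv.
by apply: (IH p) => //; case/andP: F0.
Qed.

End Elimination.

(** * The pressure as the abscissa of convergence of loop sums *)

Section ExtendLoops.
Variables (R : realType) (M : rel nat) (Mtrans : transitive_shift M).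
Variables (wt : nat -> seq nat -> R) (K : R).
Hypothesis qm : quasi_multiplicative M wt K.

(** Surrounding walks by fixed [u] and [v] is injective and changes weights by
    a bounded factor, so sums over walks with different ends are comparable. *)
Lemma total_extend x y x' y' u v :
  walk M x' x u -> walk M y y' v ->
  exists2 c : R, 0 < c & forall D D', D `<=` walk M x y ->
    (forall w, D w -> D' (u ++ w ++ v)) ->
    (total wt x D <= c%:E * total wt x' D')%E.
Proof.
move=> hu hv; have K1 := qm_const qm; have K0 : 0 < K := lt_le_trans ltr01 K1.
have u0 := qm_gt0 qm x' u; have v0 := qm_gt0 qm y v.
exists (K ^+ 2 / (wt x' u * wt y v)); first by rewrite divr_gt0 ?exprn_gt0 ?mulr_gt0.
have c0 : 0 <= K ^+ 2 / (wt x' u * wt y v).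
  by rewrite divr_ge0 ?mulr_ge0 ?exprn_ge0 // ltW.
move=> D D' Dxy DD'.
apply: (@le_trans _ _ ((K ^+ 2 / (wt x' u * wt y v))%:E
    * \esum_(w in D) (wt x' (u ++ w ++ v))%:E)%E).
  rewrite -esumZl//; last by move=> w _; rewrite lee_fin ltW// (qm_gt0 qm).
  apply: le_esum => w /Dxy hw; rewrite -EFinM lee_fin.
  rewrite mulrAC ler_pdivlMr ?mulr_gt0//.
  have := qm_ge qm (walk_cat hu hw) hv; rewrite -catA => h2.
  have h1 := qm_ge qm hu hw.
  apply: (@le_trans _ _ (K * wt x' (u ++ w) * wt y v)).
    by rewrite mulrA (mulrC (wt x w)) ler_pM2r.
  by rewrite expr2 -!mulrA ler_pM2l.
apply: lee_wpmul2l; first by rewrite lee_fin.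
apply: (le_esum_inj (e := fun w => u ++ w ++ v) (fun w => (wt x' w)%:E)).
  move=> w w' _ _ /eqP; rewrite eqseq_cat// eqxx/= => /eqP e.
  have sw : size w = size w'.
    by move/(congr1 size): e; rewrite !size_cat => /addIn.
  by move/eqP: e; rewrite eqseq_cat// => /andP[/eqP].
by move=> _ [w Dw <-]; exact: DD'.
Qed.

Lemma total_extend_finite x y x' y' u v (D D' : set (seq nat)) :
  walk M x' x u -> walk M y y' v -> D `<=` walk M x y ->
  (forall w, D w -> D' (u ++ w ++ v)) ->
  (total wt x' D' < +oo)%E -> (total wt x D < +oo)%E.
Proof.
move=> hu hv Dxy DD' fin; have [c c0 cD] := total_extend hu hv.
have [a a0 aE] := total_finite qm fin.
by apply: le_lt_trans (cD _ _ Dxy DD') _; rewrite aE -EFinM ltry.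
Qed.

Lemma total_walks_finite x y b : (0 < x)%N -> (0 < y)%N -> (0 < b)%N ->
  (total wt b (walk M b b) < +oo)%E -> (total wt x (walk M x y) < +oo)%E.
Proof.
move=> x0 y0 b0; have [u hu _] := walk_exists Mtrans b0 x0.
have [v hv _] := walk_exists Mtrans y0 b0.
apply: (total_extend_finite hu hv (@subset_refl _ _)) => w hw.
exact: walk_cat hu (walk_cat hw hv).
Qed.

Lemma long_loop b N : (0 < b)%N -> exists2 g, walk M b b g & (N <= size g)%N.
Proof.
move=> b0; have [g hg g0] := walk_exists Mtrans b0 b0.
elim: N => [|N [h hh Nh]]; first by exists g.
exists (g ++ h); first exact: walk_cat hg hh.
by rewrite size_cat -add1n leq_add// lt0n size_eq0.
Qed.

End ExtendLoops.

Section PeriodicPoints.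
Variable M : rel nat.

Definition periodic_point (b : nat) (w : seq nat) : nat -> nat :=
  fun i => nth 0%N (b :: w) (i %% size w).

Lemma Sigma_periodic_point b w : walk M b b w -> w != [::] ->
  Sigma M (periodic_point b w).
Proof.
move=> [/andP[w0 pw] lw] wn i; rewrite /periodic_point.
have s0 : (0 < size w)%N by rewrite lt0n size_eq0.
have im := ltn_pmod i s0.
split; first by move/allP: w0; apply; rewrite mem_nth//= ltnW.
have -> : nth 0%N (b :: w) (i.+1 %% size w) = nth 0%N w (i %% size w).
  rewrite modnS; case: ifP => [dv|//].
  have -> : (i %% size w = (size w).-1)%N.
    have h : ((i %% size w).+1 %% size w = 0)%N.
      by rewrite -addn1 modnDml addn1; apply/eqP.
    move: im; rewrite leq_eqVlt => /orP[/eqP e|lt].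
      by rewrite -[in RHS]e.
    by rewrite (modn_small lt) in h.
  by rewrite nth_last; case: (w) wn lw.
exact: (pathP 0%N pw).
Qed.

Lemma iter_periodic_point b w :
  iter (size w) shiftmap (periodic_point b w) = periodic_point b w.
Proof.
by apply/funext => i; rewrite iter_shift /periodic_point addnC modnDr.
Qed.

Lemma moves_periodic_point b w : walk M b b w -> w != [::] ->
  periodic_point b w 0%N = b /\ moves (size w) (periodic_point b w) = w.
Proof.
move=> [_ lw] wn; have s0 : (0 < size w)%N by rewrite lt0n size_eq0.
rewrite /periodic_point mod0n; split=> //.
apply: (@eq_from_nth _ 0%N); rewrite size_moves// => i iw.
rewrite nth_mkseq//; have := iw; rewrite leq_eqVlt => /orP[/eqP e|iw'].
  have ei : i = (size w).-1 by rewrite -e.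
  by rewrite e modnn/= ei nth_last; case: (w) wn lw.
by rewrite modn_small.
Qed.

Lemma moves_periodic_inj n z z' : iter n shiftmap z = z -> iter n shiftmap z' = z' ->
  (0 < n)%N -> moves n z = moves n z' -> z = z'.
Proof.
move=> zn zn' n0 e.
have step i : (0 < i <= n)%N -> z i = z' i.
  case: i => [//|i] /= le.
  by have := congr1 (fun s => nth 0%N s i) e; rewrite !nth_mkseq.
apply/funext => i; have [m] := ubnP i; elim: m i => [//|m IH] i im.
have [ni|lt] := leqP n i.
  rewrite -(subnKC ni) -iter_shift -[z' _]iter_shift zn zn'; apply: IH.
  by move: im ni n0; lia.
case: i im lt => [_ _|i im lt]; last by apply: step; exact: ltnW.
have := congr1 (@^~ 0%N) zn; have := congr1 (@^~ 0%N) zn'.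
rewrite !iter_shift addn0 => <- <-; apply: step; by rewrite n0 leqnn.
Qed.

Lemma birkhoff_cst (R : realType) (phi : (nat -> nat) -> R) p n z :
  birkhoff shiftmap (fun x => phi x + p) n z = birkhoff shiftmap phi n z + p * n%:R.
Proof.
rewrite /birkhoff big_split/=; congr (_ + _).
by rewrite big_const_nat iter_addr_0 subn0 mulr_natr.
Qed.

End PeriodicPoints.

Section Pressure.
Variables (R : realType) (M : rel nat) (Mtrans : transitive_shift M).
Variables (phi : (nat -> nat) -> R) (K : R).
Hypothesis dist : bounded_distortion M phi K.

Let wt := weight M phi.
Let qm := quasi_multiplicative_weight Mtrans dist.
Let K0 : 0 < K := lt_le_trans ltr01 dist.1.

Definition loops_of_length b n : set (seq nat) :=
  [set w | walk M b b w /\ size w = n].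

Let gsum b n := gurevich_sum (Sigma M) shiftmap (fun x => x 0%N) phi b n.

Lemma total_loops_le b n : (0 < n)%N ->
  (total wt b (loops_of_length b n) <= K%:E * gsum b n)%E.
Proof.
move=> n0; rewrite /gsum /gurevich_sum -esumZl ?(ltW K0)//.
set E := [set x | _].
apply: (@le_trans _ _ (\esum_(z in E) (wt b (moves n z))%:E)%E).
  apply: (le_esum_surj (e := moves n) (f := fun w => (wt b w)%:E)).
    by move=> w _; rewrite lee_fin expR_ge0.
  move=> w [hw sw]; have wn : w != [::] by rewrite -size_eq0 sw -lt0n.
  exists (periodic_point b w); last by rewrite -sw; have [] := moves_periodic_point hw wn.
  split; first exact: Sigma_periodic_point.
    by rewrite -sw iter_periodic_point.
  by have [] := moves_periodic_point hw wn.
apply: le_esum => z [Sz zn zb]; rewrite -EFinM lee_fin.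
have := weight_point_le dist (cylinder_moves n Sz).
by rewrite size_moves zb.
Qed.

Lemma gurevich_sum_le b n : (0 < n)%N ->
  (gsum b n <= K%:E * total wt b (loops_of_length b n))%E.
Proof.
move=> n0; rewrite /gsum /gurevich_sum -esumZl ?(ltW K0)//; last first.
  by move=> w _; rewrite lee_fin expR_ge0.
set E := [set x | _].
apply: (@le_trans _ _ (\esum_(z in E) (K%:E * (wt b (moves n z))%:E))%E).
  apply: le_esum => z [Sz zn zb]; rewrite -EFinM lee_fin.
  have := weight_point_ge dist (cylinder_moves n Sz).
  by rewrite size_moves zb.
apply: (le_esum_inj (e := moves n) (fun w => (K%:E * (wt b w)%:E)%E)).
  by move=> z z' /[!inE] -[_ zn _] [_ zn' _]; exact: moves_periodic_inj.
move=> _ [z [Sz zn zb] <-]; split; last exact: size_moves.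
have zn0 : z n = z 0%N by have := congr1 (@^~ 0%N) zn; rewrite iter_shift addn0.
by have := walk_moves n Sz; rewrite zn0 zb.
Qed.

Lemma gurevich_at_le_pressure b : (0 < b)%N ->
  (gurevich_at (Sigma M) shiftmap (fun x => x 0%N) phi b <= pressure M phi)%E.
Proof.
move=> b0; have [z [Sz zb]] := Sigma_through Mtrans b0.
by apply: ereal_sup_ubound; exists b => //; exists z.
Qed.

Lemma total_tilt_length p b n :
  total (tilt p wt) b (loops_of_length b n)
  = ((expR (p * n%:R))%:E * total wt b (loops_of_length b n))%E.
Proof.
rewrite /total -esumZl ?expR_ge0//; last by move=> w _; rewrite lee_fin expR_ge0.
by apply: eq_esum => w [_ sw]; rewrite /tilt sw -EFinM mulrC.
Qed.

(** A rate below [- p] makes the sums over long loops decay geometrically. The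
    sums over loops of a given short length are finite because prefixing a
    fixed long loop turns them into long ones. *)
Lemma loops_converge_below_pressure p b : (pressure M phi < (- p)%:E)%E ->
  (0 < b)%N -> (total (tilt p wt) b (walk M b b) < +oo)%E.
Proof.
move=> Pp b0; have [c Pc cp] := real_between Pp.
have [n0 rate] := limn_esup_lt (le_lt_trans (gurevich_at_le_pressure b0) Pc).
have qmp := quasi_multiplicative_tilt p qm.
have big n : (n0.+1 <= n)%N ->
    (total (tilt p wt) b (loops_of_length b n) <= (K * expR (c + p) ^+ n)%:E)%E.
  move=> nn; have n_gt0 : (0 < n)%N by apply: leq_trans nn.
  rewrite total_tilt_length.
  have gs : (gsum b n <= (expR (c * n%:R))%:E)%E.
    apply: log_rate_lt => //; last by apply: rate; exact: ltnW.
    by apply: esum_ge0 => z _; rewrite lee_fin expR_ge0.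
  apply: (@le_trans _ _ ((expR (p * n%:R))%:E * (K * expR (c * n%:R))%:E)%E).
    apply: lee_wpmul2l; first by rewrite lee_fin expR_ge0.
    apply: le_trans (total_loops_le b n_gt0) _; rewrite EFinM.
    by apply: lee_wpmul2l => //; rewrite lee_fin ltW.
  rewrite -EFinM lee_fin mulrCA ler_pM2l// -expRD -expRM_natr.
  by rewrite ler_expR -mulrDl addrC.
have fin n : (total (tilt p wt) b (loops_of_length b n) < +oo)%E.
  have [g hg gn] := long_loop Mtrans n0.+1 b0.
  apply: (total_extend_finite qmp hg (walk_nil M b0)
    (D' := loops_of_length b (size g + n))) => [w []//|w [hw sw]|].
    by rewrite cats0; split; [exact: walk_cat hg hw|rewrite size_cat sw].
  by apply: le_lt_trans (big _ _) (ltry _); rewrite (leq_trans gn)// leq_addr.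
have cover : walk M b b `<=` \bigcup_n loops_of_length b n.
  by move=> w hw; exists (size w).
apply: le_lt_trans (esum_bigcup_le _ cover) _.
  by move=> w; rewrite lee_fin ltW// (qm_gt0 qmp).
apply: (nneseries_geometric_lty (n0 := n0.+1) (C := K) (r := expR (c + p))) => //.
- by move=> n; exact: total_ge0 qmp _ _.
- exact: ltW.
- by rewrite expR_ge0/= -expR0 ltr_expR; lra.
Qed.

Lemma walks_converge_below_pressure p x y : (pressure M phi < (- p)%:E)%E ->
  (0 < x)%N -> (0 < y)%N -> (total (tilt p wt) x (walk M x y) < +oo)%E.
Proof.
move=> Pp x0 y0; have qmp := quasi_multiplicative_tilt p qm.
apply: (total_walks_finite Mtrans qmp x0 y0 x0).
exact: loops_converge_below_pressure.
Qed.

(** Convergence at the letter [a] gives convergence at every letter, hence an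
    exponential bound on the sums over periodic points in every cylinder that
    enters the supremum. *)
Lemma pressure_le_of_convergence p a : (0 < a)%N ->
  (total (tilt p wt) a (walk M a a) < +oo)%E -> (pressure M phi <= (- p)%:E)%E.
Proof.
move=> a0 afin; have qmp := quasi_multiplicative_tilt p qm.
apply: ge_ereal_sup => _ [_ [z Sz <-] <-]; set b := z 0%N.
have b0 : (0 < b)%N := (Sz 0%N).1.
have [G G0 GE] := total_finite qmp (total_walks_finite Mtrans qmp b0 b0 a0 afin).
apply/lee_addgt0Pr => e e0; rewrite -EFinD.
have [n0 hn0] := expR_eventually_ge (K * G) e0.
apply: (limn_esup_le (n0 := n0.+1)) => n nn.
have n_gt0 : (0 < n)%N by apply: leq_trans nn.
apply: log_rate_le => //; apply: le_trans (gurevich_sum_le b n_gt0) _.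
have -> : total wt b (loops_of_length b n) =
   ((expR (- p * n%:R))%:E * total (tilt p wt) b (loops_of_length b n))%E.
  by rewrite total_tilt_length muleA -EFinM -expRD mulNr addNr expR0 mul1e.
apply: (@le_trans _ _ (K%:E * ((expR (- p * n%:R))%:E * G%:E))%E).
  apply: lee_wpmul2l; first by rewrite lee_fin ltW.
  apply: lee_wpmul2l; first by rewrite lee_fin expR_ge0.
  by rewrite -GE; apply: le_esum_set => w [].
rewrite -!EFinM lee_fin mulrDl expRD [leLHS]mulrCA ler_wpM2l ?expR_ge0//.
exact/hn0/ltnW.
Qed.

End Pressure.

(** * The induced system *)

Section ReturnTimes.
Variables (M : rel nat) (a : nat).
Implicit Types (z : nat -> nat) (w : seq nat).

Lemma return_timeP z m : (0 < m)%N -> z m = a ->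
  (forall i, (0 < i < m)%N -> z i != a) -> return_time a z = m.
Proof.
move=> m0 zm zi; rewrite /return_time; case: pselect => [e|]; last first.
  by case; exists m; rewrite m0 zm eqxx.
case: ex_minnP => k /andP[k0 /eqP zk] kmin; apply/eqP; rewrite eqn_leq.
rewrite kmin ?m0 ?zm ?eqxx//= leqNgt; apply/negP => km.
by have := zi k; rewrite k0 km zk eqxx => /(_ isT).
Qed.

Lemma return_time_recurrent z : recurrent M a z ->
  [/\ (0 < return_time a z)%N, z (return_time a z) = a &
      forall i, (0 < i < return_time a z)%N -> z i != a].
Proof.
move=> [_ zrec]; rewrite /return_time; case: pselect => [e|]; last first.
  by have [k [k1 zk]] := zrec 1%N; case; exists k; rewrite k1 zk eqxx.
case: ex_minnP => k /andP[k0 /eqP zk] kmin; split=> // i /andP[i0 ik].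
by apply: contraTneq ik => zi; rewrite -leqNgt kmin// i0 zi eqxx.
Qed.

Lemma recurrent_shift n z : recurrent M a z -> z n = a ->
  recurrent M a (iter n shiftmap z).
Proof.
move=> [[Sz _] zrec] zn; split.
  split; first exact: Sigma_shift.
  by move=> [|//] _; rewrite iter_shift addn0.
move=> N; have [k [Nk zk]] := zrec (n + N)%N.
exists (k - n)%N; rewrite iter_shift subnKC//; last exact: leq_trans (leq_addr _ _) Nk.
by split=> //; rewrite leq_subRL// (leq_trans (leq_addr _ _) Nk).
Qed.

Lemma recurrent_return_map z : recurrent M a z -> recurrent M a (return_map a z).
Proof.
by move=> rz; apply: recurrent_shift => //; have [_ -> _] := return_time_recurrent rz.
Qed.

Definition nth_return k z : nat :=
  (\sum_(0 <= i < k) return_time a (iter i (return_map a) z))%N.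

Lemma nth_returnS k z :
  nth_return k.+1 z = (return_time a z + nth_return k (return_map a z))%N.
Proof.
rewrite /nth_return big_nat_recl//; congr addn; apply: eq_bigr => i _.
by rewrite -iterSr.
Qed.

(** The induced system is read in the original time, so that its periodic points
    and Birkhoff sums become those of the shift. *)
Lemma iter_return_map k z :
  iter k (return_map a) z = iter (nth_return k z) shiftmap z.
Proof.
elim: k z => [|k IH] z; first by rewrite /nth_return big_geq.
by rewrite iterSr IH nth_returnS addnC iterD.
Qed.

Lemma birkhoff_return_map (R : realType) (psi : (nat -> nat) -> R) k z :
  birkhoff (return_map a) (induced_potential a psi) k z
  = birkhoff shiftmap psi (nth_return k z) z.
Proof.
elim: k z => [|k IH] z; first by rewrite /nth_return /birkhoff !big_geq.
rewrite nth_returnS birkhoffD -IH /birkhoff big_nat_recl//; congr (_ + _).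
by apply: eq_bigr => i _; rewrite -iterSr.
Qed.

Lemma moves_add m n z : moves (m + n) z = moves m z ++ moves n (iter m shiftmap z).
Proof.
apply: (@eq_from_nth _ 0%N); first by rewrite size_cat !size_moves.
move=> i; rewrite size_moves => imn; rewrite nth_mkseq// nth_cat size_moves.
case: ltnP => im; first by rewrite nth_mkseq.
rewrite nth_mkseq ?ltn_subLR// iter_shift; congr z.
by rewrite addnS subnKC.
Qed.

Lemma first_loop_moves z : recurrent M a z ->
  first_loop M a (moves (return_time a z) z).
Proof.
move=> rz; have [n0 zn zi] := return_time_recurrent rz.
have [[Sz za] _] := rz; have z0 : z 0%N = a by exact: (za 0%N).
split; first by have := walk_moves (return_time a z) Sz; rewrite zn z0.
exists (moves (return_time a z).-1 z).
  by rewrite -{1}(prednK n0) /moves mkseqS prednK// zn.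
apply/allP => l /mapP[i]; rewrite mem_iota => /andP[_ il] ->; rewrite inE.
by apply: zi; move: il n0; lia.
Qed.

Lemma concat_pow_moves k z : recurrent M a z ->
  concat_pow (first_loop M a) k (moves (nth_return k z) z).
Proof.
elim: k z => [|k IH] z rz; first by rewrite /nth_return big_geq.
rewrite nth_returnS moves_add; exists (moves (return_time a z) z).
  exact: first_loop_moves.
by exists (moves (nth_return k (return_map a z)) (return_map a z)) => //;
  apply/IH/recurrent_return_map.
Qed.

Lemma return_time_moves v z : first_loop M a v -> moves (size v) z = v ->
  return_time a z = size v.
Proof.
move=> [_ [u vE ua]]; rewrite vE size_rcons => mz.
have zE i : (i < (size u).+1)%N -> z i.+1 = nth 0%N (rcons u a) i.
  by move=> iu; rewrite -mz nth_mkseq.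
apply: return_timeP => //; first by rewrite zE// nth_rcons ltnn eqxx.
move=> [//|i] /= iu; rewrite zE; last exact: ltnW.
have {}iu : (i < size u)%N by [].
rewrite nth_rcons iu; have := allP ua (nth 0%N u i) (mem_nth _ iu).
by rewrite inE.
Qed.

Lemma nth_return_moves k w z : concat_pow (first_loop M a) k w ->
  moves (size w) z = w -> nth_return k z = size w.
Proof.
elim: k w z => [|k IH] w z; first by move=> -> _; rewrite /nth_return big_geq.
move=> [v hv [w' hw' <-]]; rewrite size_cat moves_add => /eqP.
rewrite eqseq_cat ?size_moves// => /andP[/eqP mv /eqP mw'].
have rv := return_time_moves hv mv.
by rewrite nth_returnS /return_map rv (IH w').
Qed.

Lemma recurrent_periodic_point w : walk M a a w -> w != [::] ->
  recurrent M a (periodic_point a w).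
Proof.
move=> hw wn; have [p0 _] := moves_periodic_point hw wn.
split; first by split; [exact: Sigma_periodic_point|case].
move=> N; exists (N * size w)%N; split.
  by rewrite leq_pmulr// lt0n size_eq0.
by rewrite /periodic_point modnMl.
Qed.

Lemma concat_pow_size k w : concat_pow (first_loop M a) k w -> (k <= size w)%N.
Proof.
elim: k w => [//|k IH] w [v [_ [u -> _]] [w' /IH kw' <-]].
by rewrite size_cat size_rcons addSn ltnS (leq_trans kw')// leq_addl.
Qed.

Lemma loops_concat_pow w : walk M a a w ->
  (\bigcup_k concat_pow (first_loop M a) k) w.
Proof.
have [n] := ubnP (size w); elim: n w => [//|n IH] w wn hw.
have [->|w0] := eqVneq w [::]; first by exists 0%N.
have : a \in w by case: w hw w0 {wn} => [//|c w] [_ /= <-] _; exact: mem_last.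
rewrite -has_pred1 => aw; move: hw wn {w0}.
case: (split_find aw) => _ s1 s2 /eqP -> s1a hw wn.
have [h1 h2] := walk_split hw; rewrite last_rcons in h1 h2.
have [|k _ hk] := IH s2 _ h2.
  by move: wn; rewrite size_cat size_rcons; lia.
exists k.+1 => //; exists (rcons s1 a); last by exists s2.
split=> //; exists s1 => //; apply/allP => l ls1; rewrite inE.
by apply: contraNneq s1a => <-; rewrite has_pred1.
Qed.

Lemma concat_pow_add (A : set (seq nat)) i j u w :
  concat_pow A i u -> concat_pow A j w -> concat_pow A (i + j) (u ++ w).
Proof.
elim: i u => [|i IH] u; first by move=> ->.
move=> [v Av [u' hu' <-]] hw; exists v => //; exists (u' ++ w).
  exact: IH.
by rewrite catA.
Qed.

End ReturnTimes.

Section InducedPressure.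
Variables (R : realType) (M : rel nat) (Mtrans : transitive_shift M).
Variables (phi : (nat -> nat) -> R) (K : R).
Hypothesis dist : bounded_distortion M phi K.
Variables (a : nat) (a0 : (0 < a)%N).

Let wt := weight M phi.
Let qm := quasi_multiplicative_weight Mtrans dist.
Let K0 : 0 < K := lt_le_trans ltr01 dist.1.
Let FL := first_loop M a.

Let isum p v k := gurevich_sum (recurrent M a) (return_map a) (return_word a)
    (induced_potential a (fun x => phi x + p)) v k.

Let FLwalk : FL `<=` walk M a a := @excursion_walk M [:: a] a a.

Lemma induced_sum_le p v k : (0 < k)%N ->
  (isum p v k <= K%:E * total (tilt p wt) a (concat_pow FL k))%E.
Proof.
move=> k0; have qmp := quasi_multiplicative_tilt p qm.
rewrite /isum /gurevich_sum -esumZl ?(ltW K0)//; last first.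
  by move=> w _; rewrite lee_fin ltW// (qm_gt0 qmp).
set E := [set x | _]; pose e z := moves (nth_return a k z) z.
apply: (@le_trans _ _ (\esum_(z in E) (K%:E * (tilt p wt a (e z))%:E))%E).
  apply: le_esum => z [rz zk zv]; rewrite -EFinM lee_fin.
  have [[Sz za] _] := rz; have z0 : z 0%N = a by exact: (za 0%N).
  rewrite birkhoff_return_map birkhoff_cst expRD /tilt /e size_moves mulrA.
  apply: ler_wpM2r; first exact: expR_ge0.
  have := weight_point_ge dist (cylinder_moves (nth_return a k z) Sz).
  by rewrite size_moves z0.
apply: (le_esum_inj (e := e) (fun w => (K%:E * (tilt p wt a w)%:E)%E)).
  move=> z z' /[!inE] -[rz zk _] [rz' zk' _] ee.
  have nE : nth_return a k z = nth_return a k z'.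
    by have := congr1 size ee; rewrite !size_moves.
  rewrite iter_return_map in zk; rewrite iter_return_map -nE in zk'.
  apply: (moves_periodic_inj zk zk'); last by rewrite {2}nE.
  by apply: leq_trans k0 _; rewrite -(size_moves (nth_return a k z) z);
    apply: concat_pow_size (concat_pow_moves k rz).
by move=> _ [z [rz zk zv] <-]; exact: concat_pow_moves.
Qed.

(** Up to distortion, the sum over [k] returns is at most the [k]-th power of
    the sum over first return loops, whichever return word comes first. *)
Lemma induced_pressure_lty p : (total (tilt p wt) a FL < +oo)%E ->
  (induced_pressure M a (fun x => phi x + p)%R < +oo)%E.
Proof.
move=> fin; have qmp := quasi_multiplicative_tilt p qm.
have [c c0 cE] := total_finite qmp fin.
have K20 : 0 < K ^+ 2 by rewrite exprn_gt0.
pose d := ln (K ^+ 2 * c + 1).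
have [n0 hn0] := expR_eventually_ge (K * K ^+ 2) (@ltr01 R).
apply: (@le_lt_trans _ _ (d + 1)%:E); last exact: ltry.
apply: ge_ereal_sup => _ [v [z _ <-] <-].
apply: (limn_esup_le (n0 := n0.+1)) => k kn.
have k0 : (0 < k)%N by apply: leq_trans kn.
apply: log_rate_le => //; apply: le_trans (induced_sum_le p _ k0) _.
apply: (@le_trans _ _ (K%:E * (K ^+ 2 * (K ^+ 2 * c) ^+ k)%:E)%E).
  apply: lee_wpmul2l; first by rewrite lee_fin ltW.
  by apply: (total_concat_pow qmp k a0 FLwalk); rewrite cE.
rewrite -EFinM lee_fin mulrDl expRD mulrA [leRHS]mulrC.
have c20 : 0 <= K ^+ 2 * c by rewrite mulr_ge0// ltW.
apply: ler_pM; rewrite ?exprn_ge0 ?mulr_ge0 ?(ltW K0) ?(ltW K20)//.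
  exact/hn0/ltnW.
rewrite expRM_natr /d lnK ?posrE; last lra.
by apply: lerXn2r; rewrite ?nnegrE//; lra.
Qed.

(** Prefixing [g] turns concatenations of [k] first return loops into periodic
    points of the induced system whose first return word is the letter of [g]:
    one induced letter suffices to bound all loops with [k] returns. *)
Lemma induced_sum_ge p g k : FL g ->
  (total (tilt p wt) a [set (g ++ w)%SEQ | w in concat_pow FL k]
   <= K%:E * isum p (take (size g) (a :: g)) k.+1)%E.
Proof.
move=> hg; have qmp := quasi_multiplicative_tilt p qm.
rewrite /isum /gurevich_sum -esumZl ?(ltW K0)//.
set D := [set (g ++ w)%SEQ | w in _].
have DP u : D u -> [/\ walk M a a u, u != [::] & concat_pow FL k.+1 u].
  move=> [w hw <-]; split.
  - exact: walk_cat (FLwalk hg) (concat_pow_walk a0 FLwalk hw).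
  - by case: hg => _ [s -> _]; rewrite -size_eq0 size_cat size_rcons.
  - by exists g => //; exists w.
have retE u : D u -> nth_return a k.+1 (periodic_point a u) = size u.
  move=> /DP[hu un ku]; apply: nth_return_moves ku _.
  by have [] := moves_periodic_point hu un.
apply: (@le_trans _ _ (\esum_(u in D) (K%:E * (expR (birkhoff (return_map a)
   (induced_potential a (fun x => phi x + p)) k.+1 (periodic_point a u)))%:E))%E).
  apply: le_esum => u Du; have [hu un ku] := DP u Du.
  rewrite -EFinM lee_fin birkhoff_return_map birkhoff_cst retE// expRD /tilt mulrA.
  apply: ler_wpM2r; first exact: expR_ge0.
  have := cylinder_moves (size u) (Sigma_periodic_point hu un).
  have [-> ->] := moves_periodic_point hu un.
  exact: weight_point_le.
apply: (le_esum_inj (e := periodic_point a) (fun z => (K%:E * (expR (birkhoff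
   (return_map a) (induced_potential a (fun x => phi x + p)) k.+1 z))%:E)%E)).
  move=> u u' /[!inE] Du Du' uu'; have [hu un _] := DP u Du.
  have [hu' un' _] := DP u' Du'.
  have [_ <-] := moves_periodic_point hu un; have [_ <-] := moves_periodic_point hu' un'.
  by rewrite -(retE _ Du) -(retE _ Du') uu'.
move=> _ [u Du <-]; have [hu un ku] := DP u Du; split.
- exact: recurrent_periodic_point.
- by rewrite iter_return_map retE// iter_periodic_point.
- have [w _ uE] := Du; have [p0 mu] := moves_periodic_point hu un.
  have rt : return_time a (periodic_point a u) = size g.
    apply: (return_time_moves hg); have := mu.
    rewrite -{1}uE size_cat moves_add -[X in _ = X]uE.
    by move=> /eqP; rewrite eqseq_cat ?size_moves// => /andP[/eqP].
  rewrite /return_word rt; apply: (@eq_from_nth _ 0%N).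
    by rewrite size_mkseq size_take/= ltnSn.
  rewrite size_mkseq => i ig; rewrite nth_mkseq// nth_take//.
  have iu : (i < size u)%N by rewrite -uE size_cat ltn_addr.
  rewrite /periodic_point modn_small// -uE -cat_cons nth_cat/= ltnS ltnW//.
Qed.

(** Above the negative of the pressure the induced pressure is positive:
    otherwise the sums over [k] returns would decay for a slightly smaller
    tilt, and all loops at [a] together would have a finite sum there. *)
Lemma induced_pressure_gt0 p : ((- p)%:E < pressure M phi)%E ->
  (0 < induced_pressure M a (fun x => phi x + p)%R)%E.
Proof.
move=> pP; rewrite ltNge; apply/negP => ind_le0.
have [c pc cP] : exists2 c : R, - p < c & (c%:E < pressure M phi)%E.
  have /real_between[c h1 h2] : (- pressure M phi < p%:E)%E by rewrite lteNl -EFinN.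
  by exists (- c); [rewrite ltrN2|rewrite EFinN lteNl].
suff : (pressure M phi <= c%:E)%E by rewrite leNgt cP.
rewrite -(opprK c); apply: (pressure_le_of_convergence Mtrans dist a0).
have qmp q := quasi_multiplicative_tilt q qm.
(* Half of the drop in tilt from [p] to [- c]. A walk with [k] returns has at
   least [k] steps, so the drop gains [2 * e * k], against a growth of at most
   [e * k]. *)
pose e := (p + c) / 2; have e0 : 0 < e by rewrite /e; lra.
have [s hs sa] := first_hit_exists Mtrans a0 a0; pose g := rcons s a.
have hg : FL g.
  split=> //; exists s => //; apply/allP => l ls; rewrite inE.
  by apply: contraNneq sa => <-.
have gn : g != [::] by rewrite -size_eq0 size_rcons.
pose v := take (size g) (a :: g).
have [k0 rate] : exists k0, forall k, (k0 <= k)%N ->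
    (log_rate k (isum p v k) < e%:E)%E.
  apply: limn_esup_lt; apply: (@le_lt_trans _ _ 0%E); last by rewrite lte_fin.
  apply: le_trans ind_le0; apply: ereal_sup_ubound; exists v => //.
  exists (periodic_point a g).
    exact: recurrent_periodic_point (FLwalk hg) gn.
  have [p0 mg] := moves_periodic_point (FLwalk hg) gn.
  rewrite /return_word (return_time_moves hg mg).
  apply: (@eq_from_nth _ 0%N); first by rewrite size_mkseq size_take/= ltnSn.
  rewrite size_mkseq => i ig; rewrite nth_mkseq// nth_take//.
  by rewrite /periodic_point modn_small.
have isum_le k : (k0.+1 <= k)%N -> (isum p v k <= (expR (e * k%:R))%:E)%E.
  move=> kk; apply: log_rate_lt; [exact: leq_trans kk| |exact/rate/ltnW].
  by apply: esum_ge0 => z _; rewrite lee_fin expR_ge0.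
have powE k w : concat_pow FL k w -> tilt (- c) wt a w
    <= expR (- (2 * e * k%:R)) * tilt p wt a w.
  move=> kw; rewrite /tilt mulrCA ler_wpM2l ?(ltW (qm_gt0 qm _ _))//.
  rewrite -expRD ler_expR; have kw' : (k%:R : R) <= (size w)%:R.
    by rewrite ler_nat; exact: concat_pow_size kw.
  have : 0 <= (p + c) * ((size w)%:R - k%:R) by rewrite mulr_ge0 ?subr_ge0//; lra.
  by rewrite /e; lra.
have [C C0 ext] := total_extend (qmp p) (FLwalk hg) (walk_nil M a0).
have powle k : (k0 <= k)%N -> (total (tilt p wt) a (concat_pow FL k)
    <= (C * (K * expR (e * k.+1%:R)))%:E)%E.
  move=> kk; apply: le_trans (ext _ [set (g ++ w)%SEQ | w in concat_pow FL k] _ _) _.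
  - exact: concat_pow_walk a0 FLwalk.
  - by move=> w hw; rewrite cats0; exists w.
  - rewrite EFinM; apply: lee_wpmul2l; first by rewrite lee_fin ltW.
    apply: le_trans (induced_sum_ge p k hg) _; rewrite EFinM.
    apply: lee_wpmul2l; first by rewrite lee_fin ltW.
    exact: isum_le.
have powfin k : (total (tilt p wt) a (concat_pow FL k) < +oo)%E.
  have [u hu] : exists u, concat_pow FL k0 u.
    elim: (k0) => [|j [u hu]]; first by exists [::].
    by exists (g ++ u), g => //; exists u.
  apply: (total_extend_finite (qmp p) (concat_pow_walk a0 FLwalk hu)
    (walk_nil M a0) (D' := concat_pow FL (k0 + k))).
  - exact: concat_pow_walk a0 FLwalk.
  - by move=> w hw; rewrite cats0; exact: concat_pow_add.
  - exact: le_lt_trans (powle _ (leq_addr _ _)) (ltry _).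
have step k : (total (tilt (- c) wt) a (concat_pow FL k) <=
    (expR (- (2 * e * k%:R)))%:E * total (tilt p wt) a (concat_pow FL k))%E.
  rewrite /total -esumZl ?expR_ge0//; last first.
    by move=> w _; rewrite lee_fin ltW// (qm_gt0 (qmp p)).
  by apply: le_esum => w /powE h; rewrite -EFinM lee_fin.
apply: le_lt_trans (esum_bigcup_le _ (@loops_concat_pow M a)) _.
  by move=> w; rewrite lee_fin ltW// (qm_gt0 (qmp (- c))).
apply: (nneseries_geometric_lty (n0 := k0) (C := C * (K * expR e)) (r := expR (- e))).
- by move=> k; exact: total_ge0 (qmp _) _ _.
- move=> k; apply: le_lt_trans (step k) _.
  by have [x _ ->] := total_finite (qmp p) (powfin k); rewrite -EFinM ltry.
- by rewrite mulr_ge0 ?(ltW C0)// mulr_ge0 ?expR_ge0// ltW.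
- by rewrite expR_ge0/= -expR0 ltr_expR; lra.
- move=> k kk; apply: le_trans (step k) _.
  apply: (@le_trans _ _ ((expR (- (2 * e * k%:R)))%:E
      * (C * (K * expR (e * k.+1%:R)))%:E)%E).
    by apply: lee_wpmul2l (powle k kk); rewrite lee_fin expR_ge0.
  rewrite -EFinM lee_fin -expRM_natr le_eqVlt; apply/orP; left; apply/eqP.
  have -> : expR (e * k.+1%:R) = expR e * expR (e * k%:R) :> R.
    by rewrite -expRD -natr1; congr expR; ring.
  have -> : expR (- e * k%:R) = expR (- (2 * e * k%:R)) * expR (e * k%:R) :> R.
    by rewrite -expRD; congr expR; ring.
  by ring.
Qed.

End InducedPressure.

(** * Excursions from a finite set of letters *)

Section CountingWords.
Variables (R : realType).

Lemma esum_cst_counting (T T' : choiceType) (E : set T) (D : set T') (e : T -> T') :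
  set_inj E e -> e @` E `<=` D -> (\esum_(x in E) (1 : \bar R) <= counting D)%E.
Proof.
move=> einj ED; apply: (le_trans (le_esum_inj (fun=> 1%E) einj ED)).
rewrite /counting; case: asboolP => [finD|_]; last by rewrite leey.
rewrite esum_fset// fsbig_finite//=.
by rewrite sumEFin big_const_seq count_predT iter_addr addr0.
Qed.

End CountingWords.

Section Excursions.
Variables (R : realType) (M : rel nat) (Mtrans : transitive_shift M).

Definition excursion_of_length (q x y n : nat) : set (seq nat) :=
  [set w | excursion M (iota 1 q) x y w /\ size w = n].

(** Closing up an excursion by fixed walks that lead from the letter [1] to its
    start and from its end back to [1] adds boundedly many letters, so that a
    long excursion becomes an element of [Binf], whatever the ratio [m] and for
    every smaller bound [q'] on the letters. *)
Lemma excursion_Binf q q' m x y u v n w :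
  walk M 1 x u -> walk M y 1 v -> (0 < q' <= q)%N ->
  excursion_of_length q x y n w -> (m * (size u + size v + 2) <= n)%N ->
  Binf M (size u + n + size v) m q' (cylinder M (1%N :: u ++ w ++ v)).
Proof.
move=> hu hv /andP[q0 qq] [[hw [s wE sF]] sw] mn.
have [adm lst] := walk_cat hu (walk_cat hw hv).
have sW : size (u ++ w ++ v) = (size u + n + size v)%N by rewrite !size_cat sw addnA.
exists (1%N :: u ++ w ++ v) => //; split=> //=.
- by rewrite sW.
- by rewrite -sW nth_last/= lst.
have spos : all (leq 1) s.
  by case: hw => /andP[/= /andP[_]]; rewrite wE all_rcons => /andP[].
have cs : count (fun l => (l <= q')%N) s = 0%N.
  apply/eqP; rewrite -leqn0 leqNgt -has_count; apply/hasPn => l ls.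
  have := allP sF l ls; rewrite mem_iota (allP spos l ls)/= add1n ltnS.
  by apply: contra => /leq_trans; apply.
rewrite q0 !count_cat wE -cats1 count_cat cs/= addn0 add0n.
have cu := count_size (fun l => (l <= q')%N) u.
have cv := count_size (fun l => (l <= q')%N) v.
apply: leq_trans (_ : (m * (size u + size v + 2) <= _)%N).
  rewrite leq_mul2l; apply/orP; right.
  by case: (y <= q')%N; move: cu cv; lia.
by apply: leq_trans mn _; rewrite leqW// -addnA addnCA leq_addr.
Qed.

Definition excursion_count (q x y n : nat) : \bar R :=
  (\esum_(w in excursion_of_length q x y n) 1)%E.

Lemma excursion_count_hinf (h : R) : (hinf R M < h%:E)%E ->
  exists q0, forall q x y, (q0 <= q)%N -> x \in iota 1 q -> y \in iota 1 q ->
  exists C n0, forall n, (n0 <= n)%N ->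
    (excursion_count q x y n <= (C * expR (h * n%:R))%:E)%E.
Proof.
move=> /(limn_einf_lt 1)[q0 q00] /(limn_einf_lt 0)[m _] /limn_esup_lt[n1 rate].
exists q0 => q x y q0q; rewrite !mem_iota => /andP[x0 _] /andP[y0 _].
have [u hu _] := walk_exists Mtrans (ltn0Sn 0) x0.
have [v hv _] := walk_exists Mtrans y0 (ltn0Sn 0).
exists (expR (h * (size u + size v)%:R)), (maxn n1.+1 (m * (size u + size v + 2))).
move=> n; rewrite geq_max => /andP[n1n mn].
have Nn : (n1 < size u + n + size v)%N.
  by apply: leq_trans n1n _; rewrite -addnA addnCA leq_addr.
apply: (@le_trans _ _ (counting (Binf M (size u + n + size v) m q0))).
  apply: (@esum_cst_counting R _ _ _ _ (fun w => cylinder M (1%N :: u ++ w ++ v))).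
    move=> w w' /[!inE] hw hw' ww'.
    have [z zw] := cylinder_neq0 Mtrans (walk_cat hu (walk_cat hw.1.1 hv)).
    have zw' := zw; rewrite ww' in zw'.
    have [_ mw] := moves_cylinder zw; have [_ mw'] := moves_cylinder zw'.
    have : u ++ w ++ v = u ++ w' ++ v.
      by rewrite -mw -[RHS]mw' !size_cat hw.2 hw'.2.
    move=> /eqP; rewrite eqseq_cat// eqxx/= eqseq_cat ?hw.2 ?hw'.2//.
    by move=> /andP[/eqP].
  move=> _ [w hw <-]; apply: excursion_Binf hu hv _ hw mn.
  by rewrite q00.
have -> : expR (h * (size u + size v)%:R) * expR (h * n%:R)
    = expR (h * (size u + n + size v)%:R) :> R.
  by rewrite -expRD -mulrDr -natrD; congr (expR (h * _%:R)); lia.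
apply: log_rate_lt => //; [exact: leq_trans Nn| |exact/rate/ltnW].
by rewrite /counting; case: ifP => // _; rewrite lee_fin.
Qed.

(** All excursions are walks, and the walks between two letters grow at most at
    the rate of the topological entropy. *)
Lemma excursion_count_htop : (htop R M < +oo)%E ->
  exists h : R, forall q x y, x \in iota 1 q -> y \in iota 1 q ->
  exists C, forall n, (excursion_count q x y n <= (C * expR (h * n%:R))%:E)%E.
Proof.
move=> fin; have [h hh] : exists h : R, (htop R M < h%:E)%E.
  move: fin; case: (htop R M) => [r| |]// _; last by exists 0; exact: ltNyr.
  by exists (r + 1); rewrite lte_fin ltrDl.
exists h => q x y; rewrite !mem_iota => /andP[x0 _] /andP[y0 _].
have dist := zero_distortion R M.
have qm := quasi_multiplicative_tilt (- h) (quasi_multiplicative_weight Mtrans dist).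
have [|C C0 CE] := total_finite qm
  (walks_converge_below_pressure (p := - h) Mtrans dist _ x0 y0).
  by rewrite opprK.
exists C => n; rewrite mulrC EFinM -CE -esumZl ?expR_ge0//; last first.
  by move=> w _; rewrite lee_fin ltW// (qm_gt0 qm).
apply: le_trans (le_esum_set _ (_ : excursion_of_length q x y n `<=` _)).
  apply: le_esum => w [_ sw]; rewrite -EFinM lee_fin /tilt /weight sw.
  by rewrite /birkhoff big1// expR0 mul1r -expRD mulNr subrr expR0.
by move=> w [[]].
Qed.

Variables (phi : (nat -> nat) -> R) (K : R).
Hypothesis dist : bounded_distortion M phi K.

Let wt := weight M phi.
Let qm := quasi_multiplicative_weight Mtrans dist.
Let K0 : 0 < K := lt_le_trans ltr01 dist.1.

Lemma excursion_weight_le (d : R) q0 : (deltainf M phi < d%:E)%E ->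
  exists2 q, (q0 <= q)%N & (0 < q)%N /\
    forall x y, x \in iota 1 q -> y \in iota 1 q ->
    exists C n0, 0 <= C /\ forall n w, (n0 <= n)%N -> excursion_of_length q x y n w ->
      wt x w <= C * expR (d * n%:R).
Proof.
move=> /(limn_einf_lt q0.+1)[q q0q] /(limn_einf_lt 0)[m _] /limn_esup_lt[n1 rate].
exists q; first exact: ltnW.
have q_gt0 : (0 < q)%N by apply: leq_trans q0q.
split=> // x y; rewrite !mem_iota => /andP[x0 _] /andP[y0 _].
have [u hu _] := walk_exists Mtrans (ltn0Sn 0) x0.
have [v hv _] := walk_exists Mtrans y0 (ltn0Sn 0).
have [c c0 hc] := total_extend qm hu hv.
exists (c * (K * expR (d * (size u + size v)%:R))),
  (maxn n1.+1 (m * (size u + size v + 2))).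
split; first by rewrite mulr_ge0 ?(ltW c0)// mulr_ge0 ?expR_ge0// ltW.
move=> n w; rewrite geq_max => /andP[n1n mn] hw.
have Nn : (n1 < size u + n + size v)%N.
  by apply: leq_trans n1n _; rewrite -addnA addnCA leq_addr.
have hW := walk_cat hu (walk_cat hw.1.1 hv).
have sW : size (u ++ w ++ v) = (size u + n + size v)%N.
  by rewrite !size_cat hw.2 addnA.
have [z zW] := cylinder_neq0 Mtrans hW.
have WB := excursion_Binf (q' := q) hu hv _ hw mn.
have zle : birkhoff shiftmap phi (size u + n + size v) z
    <= d * (size u + n + size v)%:R.
  have N0 : 0 < (size u + n + size v)%:R :> R by rewrite ltr0n (leq_trans _ Nn).
  rewrite -ler_pdivrMr// mulrC -lee_fin; apply: ltW.
  apply: le_lt_trans (rate _ (ltnW Nn)); apply: ereal_sup_ubound.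
  exists z => //; exists (cylinder M (1%N :: u ++ w ++ v)) => //.
  by apply: WB; rewrite q_gt0/=.
have : (total wt x [set w] <= c%:E * total wt 1 [set (u ++ w ++ v)%SEQ])%E.
  by apply: hc => [_ ->|_ ->//]; exact: hw.1.1.
rewrite /total !esum_set1 ?lee_fin ?expR_ge0// => /le_trans; apply.
rewrite -!mulrA ler_pM2l//; apply: le_trans (weight_point_le dist zW) _.
rewrite ler_pM2l// -expRD -mulrDr -natrD sW ler_expR (le_trans zle)//.
by rewrite le_eqVlt; apply/orP; left; apply/eqP; congr (_ * _%:R); lia.
Qed.

(** The tilt is chosen so that [d + h + p < 0] while [- P < p]. The finitely
    many short lengths contribute finite sums, since all walks between two
    letters converge below [- P]. *)
Lemma excursions_converge_above (d h P : R) q :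
  pressure M phi = P%:E -> d + h < P ->
  (forall x y, x \in iota 1 q -> y \in iota 1 q -> exists C n0,
     forall n, (n0 <= n)%N ->
     (excursion_count q x y n <= (C * expR (h * n%:R))%:E)%E) ->
  (forall x y, x \in iota 1 q -> y \in iota 1 q -> exists C n0, 0 <= C /\
     forall n w, (n0 <= n)%N -> excursion_of_length q x y n w ->
     wt x w <= C * expR (d * n%:R)) ->
  exists2 p, - P < p & excursions_converge M wt p (iota 1 q).
Proof.
move=> PE dhP count_le weight_le.
pose p := - ((d + h + P) / 2); exists p; first by rewrite /p; lra.
have qmt r := quasi_multiplicative_tilt r qm.
move=> x y xF yF; have [C [n0 hC]] := count_le x y xF yF.
have [D [n1 [D0 hD]]] := weight_le x y xF yF.
have x0 : (0 < x)%N by move: xF; rewrite mem_iota => /andP[].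
have y0 : (0 < y)%N by move: yF; rewrite mem_iota => /andP[].
have cover : excursion M (iota 1 q) x y `<=` \bigcup_n excursion_of_length q x y n.
  by move=> w hw; exists (size w).
apply: le_lt_trans (esum_bigcup_le _ cover) _.
  by move=> w; rewrite lee_fin ltW// (qm_gt0 (qmt p)).
apply: (nneseries_geometric_lty (n0 := maxn n0 n1) (C := D * `|C|)
   (r := expR (d + h + p))).
- by move=> n; exact: total_ge0 (qmt p) _ _.
- move=> n; pose r := - P - 1.
  have fin : (total (tilt r wt) x (walk M x y) < +oo)%E.
    apply: (walks_converge_below_pressure Mtrans dist) => //.
    by rewrite PE lte_fin /r; lra.
  have [G G0 GE] := total_finite (qmt r) fin.
  apply: (@le_lt_trans _ _ ((expR ((p - r) * n%:R))%:E * G%:E)%E); last first.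
    by rewrite -EFinM ltry.
  rewrite -GE; apply: (@le_trans _ _ ((expR ((p - r) * n%:R))%:E
      * total (tilt r wt) x (excursion_of_length q x y n))%E).
    rewrite /total -esumZl ?expR_ge0//; last first.
      by move=> w _; rewrite lee_fin ltW// (qm_gt0 (qmt r)).
    apply: le_esum => w [_ sw]; rewrite -EFinM lee_fin /tilt sw.
    have -> : expR (p * n%:R) = expR ((p - r) * n%:R) * expR (r * n%:R) :> R.
      by rewrite -expRD; congr expR; ring.
    by rewrite mulrCA.
  apply: lee_wpmul2l; first by rewrite lee_fin expR_ge0.
  by apply: le_esum_set => w [[]].
- by rewrite mulr_ge0.
- by rewrite expR_ge0/= -expR0 ltr_expR /p; lra.
- move=> n; rewrite geq_max => /andP[n0n n1n].
  apply: (@le_trans _ _ ((D * expR ((d + p) * n%:R))%:E * excursion_count q x y n)%E).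
    rewrite /excursion_count -esumZl ?mulr_ge0 ?expR_ge0//.
    apply: le_esum => w hw; rewrite mule1 lee_fin /tilt hw.2 mulrDl expRD mulrA.
    by apply: ler_wpM2r; [exact: expR_ge0|exact: hD].
  apply: (@le_trans _ _ ((D * expR ((d + p) * n%:R))%:E * (C * expR (h * n%:R))%:E)%E).
    by apply: lee_wpmul2l (hC n n0n); rewrite lee_fin mulr_ge0 ?expR_ge0.
  rewrite -EFinM lee_fin -expRM_natr.
  have -> : expR ((d + h + p) * n%:R) = expR ((d + p) * n%:R) * expR (h * n%:R) :> R.
    by rewrite -expRD; congr expR; ring.
  rewrite mulrACA ler_wpM2r ?mulr_ge0 ?expR_ge0//.
  by rewrite ler_wpM2l// ler_norm.
Qed.

End Excursions.

Theorem theorem4p1 (R : realType) (M : rel nat) (phi : (nat -> nat) -> R)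
  (Mtrans : transitive_shift M)
  (htop_fin : (htop R M < +oo)%E)
  (phi_var : summable_variations M phi)
  (pressure_fin : (pressure M phi < +oo)%E)
  (contraction : (deltainf M phi < pressure M phi)%E)
  (gap : (deltainf M phi + hinf R M < pressure M phi)%E) :
  SPR M phi.
Proof.
have [z [Sz _]] := Sigma_through Mtrans (ltn0Sn 0).
have [K dist] := summable_variations_distortion (ex_intro _ z Sz) phi_var.
have [P PE] : exists P, pressure M phi = P%:E.
  move: pressure_fin (contraction); case: (pressure M phi) => [P _ _|//|_].
    by exists P.
  by rewrite ltNge leNye.
rewrite PE in contraction gap.
have [d [h [dd dhP [q0 count_le]]]] : exists d h : R,
    [/\ (deltainf M phi < d%:E)%E, d + h < P & exists q0, forall q x y,
      (q0 <= q)%N -> x \in iota 1 q -> y \in iota 1 q -> exists C n0,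
      forall n, (n0 <= n)%N ->
      (excursion_count R M q x y n <= (C * expR (h * n%:R))%:E)%E].
  have [hoo|hfin] := eqVneq (hinf R M) +oo%E.
    (* In the extended reals [-oo + +oo = -oo], so [gap] allows this case; the
       finite topological entropy then bounds the number of excursions, and
       [d] is free because [deltainf M phi = -oo]. *)
    have dN : deltainf M phi = -oo%E.
      by move: gap contraction; rewrite hoo; case: (deltainf M phi).
    have [h hcount] := excursion_count_htop Mtrans htop_fin.
    exists (P - h - 1), h; split; [by rewrite dN ltNyr|lra|].
    exists 0%N => q x y _ xF yF; have [C hC] := hcount q x y xF yF.
    by exists C, 0%N.
  have [d [h [hh dd dhP]]] : exists d h : R,
      [/\ (hinf R M < h%:E)%E, (deltainf M phi < d%:E)%E & d + h < P].
    move: contraction gap hfin.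
    case: (deltainf M phi) => [d| |]//; case: (hinf R M) => [h| |]//=.
    - rewrite -EFinD !lte_fin => dP dhP _.
      exists (d + (P - d - h) / 3), (h + (P - d - h) / 3).
      by rewrite !lte_fin; split; lra.
    - by exists (d + 1), (P - d - 2); rewrite ltNyr lte_fin; split=> //; lra.
    - by exists (P - h - 2), (h + 1); rewrite ltNyr lte_fin; split=> //; lra.
    - by exists (P - 1), 0; rewrite !ltNyr; split=> //; lra.
  exists d, h; split=> //; have [q0 hq0] := excursion_count_hinf Mtrans hh.
  by exists q0.
have [q q0q [q1 weight_le]] := excursion_weight_le Mtrans dist q0 dd.
have [p0 Pp0 conv] := excursions_converge_above Mtrans dist PE dhP
  (fun x y => count_le q x y q0q) weight_le.
have sub p b : p < - P -> (0 < b)%N ->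
    (total (tilt p (weight M phi)) b (walk M b b) < +oo)%E.
  move=> pP b0; apply: (loops_converge_below_pressure Mtrans dist) => //.
  by rewrite PE lte_fin; lra.
have [||a [p [a0 Pp convp]]] := eliminate_letters Mtrans
  (quasi_multiplicative_weight Mtrans dist) sub Pp0 _ (iota_uniq 1 q) _ conv.
- by apply/allP => l; rewrite mem_iota => /andP[].
- by rewrite -size_eq0 size_iota -lt0n.
exists a; split=> //.
have ind_fin : (induced_pressure M a (fun x => phi x + p)%R < +oo)%E.
  by apply: (induced_pressure_lty Mtrans dist a0); apply: convp; rewrite mem_head.
have : (p%:E <= pstar M a phi)%E by apply: ereal_sup_ubound; exists p.
rewrite /discriminant; case: (pstar M a phi) => [r| |]//; rewrite lee_fin => pr.
by apply: (induced_pressure_gt0 Mtrans dist a0); rewrite PE lte_fin; lra.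
Qed.
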